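(* Let $g,k\geq 2$ and let $G=\pi_1(\Sigma_g)\times \mathbb{Z}^k$ or $G=F_g\times \mathbb{Z}^k$. Then $$\{\mathrm{rk}(\mathrm{Fix}\,\phi)\mid \phi\in \mathrm{Aut}(G)\}=\mathbb{N}\cup\{\aleph_0\},$$ and hence $G$ contains, up to isomorphism, infinitely many fixed subgroups of automorphisms.
   Context: $F_g$ is the free group of rank $g$; $\Sigma_g$ is the closed orientable surface of genus $g$. For a group $G$ and $\phi\in\mathrm{Aut}(G)$, $\mathrm{Fix}\,\phi=\{x\in G\mid \phi(x)=x\}$ is the fixed subgroup. The rank $\mathrm{rk}(K)$ of a group $K$ is the minimal cardinality of a generating set ($\aleph_0$ for a countable group that is not finitely generated). $\mathbb{N}$ includes $0$. *)

(* Defs.v *)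
From HB Require Import structures.
From mathcomp Require Import all_boot all_order all_algebra.
From mathcomp Require Import generic_quotient.
From mathcomp Require Import mathcomp_extra boolp classical_sets functions.
From mathcomp Require Import cardinality.

Set Implicit Arguments.
Unset Strict Implicit.
Unset Printing Implicit Defensive.

Local Open Scope classical_set_scope.
Local Open Scope card_scope.
Local Open Scope group_scope.

(* Groups given by generators and relators.
   The letter (x, false) stands for the generator x and (x, true) for x^-1. *)

Definition word (T : Type) := seq (T * bool).

Definition word_inv (T : Type) (w : word T) : word T :=
  rev [seq (l.1, ~~ l.2) | l <- w].

Section Presentation.
Variables (T : choiceType) (rels : set (word T)).

Inductive word_eq : word T -> word T -> Prop :=
| word_eq_refl w : word_eq w w
| word_eq_sym u v : word_eq u v -> word_eq v u
| word_eq_trans u v w : word_eq u v -> word_eq v w -> word_eq u w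
| word_eq_cat u u' v v' :
    word_eq u u' -> word_eq v v' -> word_eq (u ++ v) (u' ++ v')
| word_eq_cancel x b : word_eq [:: (x, b); (x, ~~ b)] [::]
| word_eq_rel r : rels r -> word_eq r [::].

Definition word_eqb (u v : word T) : bool := `[< word_eq u v >].

Lemma word_eqb_refl : reflexive word_eqb.
Proof. by move=> w; apply/asboolP; exact: word_eq_refl. Qed.

Lemma word_eqb_sym : symmetric word_eqb.
Proof. by move=> u v; apply/asboolP/asboolP; exact: word_eq_sym. Qed.

Lemma word_eqb_trans : transitive word_eqb.
Proof.
move=> v u w /asboolP uv /asboolP vw; apply/asboolP; exact: word_eq_trans uv vw.
Qed.

Canonical word_equiv := EquivRel word_eqb
  word_eqb_refl word_eqb_sym word_eqb_trans.

Definition presented := {eq_quot word_equiv}%qT.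

HB.instance Definition _ := Choice.on presented.
HB.instance Definition _ := Quotient.on presented.
HB.instance Definition _ := EqQuotient.on presented.

Definition class_of_word (w : word T) : presented := (\pi_presented w)%qT.

Lemma class_of_wordP u v : class_of_word u = class_of_word v <-> word_eq u v.
Proof.
split=> [/eqmodP/asboolP //|uv]; apply/eqmodP; exact/asboolP.
Qed.

Lemma repr_class w : word_eq (repr (class_of_word w)) w.
Proof. by apply/class_of_wordP; rewrite /class_of_word reprK. Qed.

Lemma class_of_repr (x : presented) : class_of_word (repr x) = x.
Proof. by rewrite /class_of_word reprK. Qed.

Lemma word_inv_cat (u v : word T) :
  word_inv (u ++ v) = word_inv v ++ word_inv u.
Proof. by rewrite /word_inv map_cat rev_cat. Qed.

Lemma word_invK : involutive (@word_inv T).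
Proof.
move=> w; rewrite /word_inv map_rev revK -map_comp -[RHS]map_id.
by apply: eq_map => -[x b] /=; rewrite negbK.
Qed.

Lemma word_mulV w : word_eq (w ++ word_inv w) [::].
Proof.
elim: w => [|[x b] w IHw]; first exact: word_eq_refl.
rewrite -cat1s word_inv_cat catA -(catA [:: (x, b)]).
apply: (word_eq_trans _ (word_eq_cancel x b)).
rewrite -[X in word_eq _ X]/([:: (x, b)] ++ [:: (x, ~~ b)]).
apply: word_eq_cat; last exact: word_eq_refl.
rewrite -[X in word_eq _ X]cats0; apply: word_eq_cat IHw.
exact: word_eq_refl.
Qed.

Lemma word_Vmul w : word_eq (word_inv w ++ w) [::].
Proof. by rewrite -{2}(word_invK w); exact: word_mulV. Qed.

Lemma word_eq_inv u v : word_eq u v -> word_eq (word_inv u) (word_inv v).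
Proof.
move=> uv; have vVv := word_Vmul v.
apply: (@word_eq_trans _ (word_inv u ++ (v ++ word_inv v))).
  rewrite -[X in word_eq X _]cats0; apply: word_eq_cat (word_eq_refl _) _.
  exact: word_eq_sym (word_mulV v).
rewrite catA -[X in word_eq _ X]cat0s; apply: word_eq_cat (word_eq_refl _).
apply: word_eq_trans (word_Vmul u); apply: word_eq_cat (word_eq_refl _) _.
exact: word_eq_sym.
Qed.

Definition presented_one : presented := class_of_word [::].
Definition presented_mul (x y : presented) : presented :=
  class_of_word (repr x ++ repr y).
Definition presented_inv (x : presented) : presented :=
  class_of_word (word_inv (repr x)).

Lemma class_of_word_cat u v :
  class_of_word (u ++ v) = presented_mul (class_of_word u) (class_of_word v).
Proof.
apply/class_of_wordP/word_eq_sym; apply: word_eq_cat; exact: repr_class.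
Qed.

Lemma class_of_word_inv w :
  class_of_word (word_inv w) = presented_inv (class_of_word w).
Proof. apply/class_of_wordP/word_eq_sym/word_eq_inv; exact: repr_class. Qed.

Lemma presented_mulA : associative presented_mul.
Proof.
move=> x y z.
rewrite -(class_of_repr x) -(class_of_repr y) -(class_of_repr z).
by rewrite -!class_of_word_cat catA.
Qed.

Lemma presented_mul1 : left_id presented_one presented_mul.
Proof. by move=> x; rewrite -(class_of_repr x) -class_of_word_cat. Qed.

Lemma presented_mulr1 : right_id presented_one presented_mul.
Proof. by move=> x; rewrite -(class_of_repr x) -class_of_word_cat cats0. Qed.

Lemma presented_mulV : left_inverse presented_one presented_inv presented_mul.
Proof.
move=> x; rewrite -(class_of_repr x) -class_of_word_inv -class_of_word_cat.
apply/class_of_wordP; exact: word_Vmul.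
Qed.

Lemma presented_mulrV : right_inverse presented_one presented_inv presented_mul.
Proof.
move=> x; rewrite -(class_of_repr x) -class_of_word_inv -class_of_word_cat.
apply/class_of_wordP; exact: word_mulV.
Qed.

HB.instance Definition _ := isGroup.Build presented presented_mulA
  presented_mul1 presented_mulr1 presented_mulV presented_mulrV.

End Presentation.

Definition free_group (g : nat) : groupType := presented (@set0 (word 'I_g)).

(* With a_i := inl i and b_i := inr i, the word \prod_(i < g) [a_i, b_i], where
   [a, b] = a b a^-1 b^-1. *)
Definition surface_relator (g : nat) : word ('I_g + 'I_g)%type :=
  flatten [seq [:: (inl i, false); (inr i, false); (inl i, true); (inr i, true)]
          | i <- enum 'I_g].

(* The fundamental group of the closed orientable surface of genus g, through
   its standard presentation < a_i, b_i | \prod_i [a_i, b_i] >. *)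
Definition surface_group (g : nat) : groupType :=
  presented [set surface_relator g].

Definition free_abelian_group (k : nat) : groupType :=
  Algebra.to_multiplicative 'rV[int]_k.

Definition dprod_group (G H : groupType) : groupType := (G * H)%type.

Section Subgroups.
Variable G : groupType.

Definition is_subgroup (K : set G) : Prop := group_closed (mem K).

Definition generates (S K : set G) : Prop := smallest is_subgroup S = K.

(* A multiplicative map between groups automatically preserves 1. *)
Definition Aut_group : set {multiplicative G -> G} :=
  [set phi | bijective phi].

Definition Fix (phi : G -> G) : set G := [set x | phi x = x].

(* Isomorphism of subgroups; the values of f outside K are irrelevant. *)
Definition sub_isog (K L : set G) : Prop :=
  exists f : G -> G,
    set_bij K L f /\ {in K &, {morph f : x y / x * y}}.

Definition iso_class (K : set G) : set (set G) :=
  [set L | is_subgroup L /\ sub_isog K L].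

End Subgroups.

(* Cardinal numbers, the uncountable ones being lumped together. *)
Inductive cardinal := FinCard of nat | Aleph0 | Uncountable.

HB.instance Definition _ := gen_eqMixin cardinal.
HB.instance Definition _ := gen_choiceMixin cardinal.

Definition has_card (T : Type) (A : set T) (c : cardinal) : Prop :=
  match c with
  | FinCard n => A #= `I_n
  | Aleph0 => A #= [set: nat]
  | Uncountable => ~ countable A
  end.

Definition is_rank (G : groupType) (K : set G) (c : cardinal) : Prop :=
  exists S : set G, [/\ generates S K, has_card S c &
    forall S' : set G, generates S' K -> S #<= S'].

(* The default value is never used, as cardinals are well-ordered. *)
Definition rk (G : groupType) (K : set G) : cardinal :=
  xget Uncountable [set c | is_rank K c].

(* Main.v *)
(* For an automorphism psi of H, a homomorphism c : H -> Z and a matrix A,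
   phi (h, v) = (psi h, A v + c h e_0) is an automorphism of H * Z^k, and A can
   be chosen so that Fix phi consists of the (h, (m, m, 0, ..)) with h in
   Fix psi and c h = n m. If Fix psi is trivial, then Fix phi has rank 0 for
   n = 1 and rank 1 for n = 0. If Fix psi is free on x and y and c is the degree
   in x, then for n > 0 Fix phi is isomorphic to a subgroup of index n of a free
   group of rank 2, hence has rank n + 1, while for n = 0 it projects onto the
   kernel of c on this free group, which is not finitely generated.

   For the free group, psi inverts all generators, respectively all but two.
   For the surface group, let a, b be the generators of the first handle, and
   C = [a, b]. The Dehn twist psi1 fixes a and b and conjugates the other
   generators by C, so that Fix psi1 = <a, b>, which is free since it is a
   retract. Inverting a and b and conjugating the other generators by
   a^-1 b^-1 gives a square root of psi1. Its fixed subgroup lies in <a, b>,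
   where it inverts the generators, so it is trivial. *)

From HB Require Import structures.
Require Import Defs.
From mathcomp Require Import all_boot all_order all_algebra.
From mathcomp Require Import mathcomp_extra boolp classical_sets functions.
From mathcomp Require Import cardinality.
From mathcomp Require Import zify.
Import Order.TTheory GRing.Theory Num.Theory.

Set Implicit Arguments.
Unset Strict Implicit.
Unset Printing Implicit Defensive.

Local Open Scope classical_set_scope.
Local Open Scope group_scope.

(** * Free products of copies of a group *)

Section Morphisms.
Variables (G H : groupType) (f : G -> H).
Hypothesis fM : {morph f : x y / x * y}.

Lemma morph_one : f 1 = 1.
Proof. by apply: (@mulgI _ (f 1)); rewrite -fM !mulg1. Qed.

Lemma morph_inv x : f x^-1 = (f x)^-1.
Proof. by apply: (@mulgI _ (f x)); rewrite -fM !mulgV morph_one. Qed.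

End Morphisms.

Section IntegerPowers.
Local Open Scope ring_scope.

Definition zpow (G : groupType) (x : G) (n : int) : G :=
  match n with Posz m => (x ^+ m)%g | Negz m => (x ^- m.+1)%g end.

Lemma zpowS (G : groupType) (x : G) n : zpow x (1 + n) = (x * zpow x n)%g.
Proof.
case: n => [n|[|n]]; first by rewrite -PoszD add1n /= expgS.
  by rewrite /= expg1 mulgV.
have -> : 1 + Negz n.+1 = Negz n by lia.
by rewrite /= [(x ^+ n.+2)%g]expgSr invgM mulgA mulgV mul1g.
Qed.

Lemma zpowD (G : groupType) (x : G) m n :
  zpow x (m + n) = (zpow x m * zpow x n)%g.
Proof.
elim/int_rect: m => [|m IHm|m IHm]; first by rewrite add0r mul1g.
  by rewrite -addn1 addnC PoszD -addrA !zpowS IHm mulgA.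
apply: (@mulgI _ x); rewrite mulgA -!zpowS.
have -> : 1 + (- m.+1%:Z + n) = - m%:Z + n by lia.
by have -> : 1 - m.+1%:Z = - m%:Z by lia.
Qed.

Lemma zpowN (G : groupType) (x : G) n : zpow x (- n) = ((zpow x n)^-1)%g.
Proof. by apply: (@mulgI _ (zpow x n)); rewrite -zpowD subrr mulgV. Qed.

End IntegerPowers.

Definition Zmul : groupType := Algebra.to_multiplicative int.

Section FreeProduct.
Variables (I : choiceType) (M : groupType).
Implicit Types (s t : seq (I * M)) (x y : I * M) (i : I) (m : M).

Definition adj x y := x.1 != y.1.

(** Normal forms of the free product of copies of [M] indexed by [I]. *)
Definition reduced s := all (fun x => x.2 != 1) s && sorted adj s.

Definition push x s :=
  if x.2 == 1 then s else
  if s is y :: s' then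
    if x.1 == y.1 then
      if x.2 * y.2 == 1 then s' else (x.1, x.2 * y.2) :: s'
    else x :: s
  else [:: x].

Lemma reduced_behead x s : reduced (x :: s) -> reduced s.
Proof. by case/andP=> /= /andP[_ sa] /path_sorted sp; apply/andP. Qed.

Lemma reduced_cons x y s :
  reduced (x :: y :: s) = [&& x.2 != 1, x.1 != y.1 & reduced (y :: s)].
Proof. by rewrite /reduced /= /adj; do !case: (_ == _); rewrite ?andbF. Qed.

Lemma reduced1 x : reduced [:: x] = (x.2 != 1).
Proof. by rewrite /reduced /= !andbT. Qed.

Lemma push_reduced x s : reduced s -> reduced (push x s).
Proof.
move=> rs; rewrite /push; have [//|x1] := eqVneq.
case: s rs => [|y s] rs; first by rewrite reduced1.
have [xy|xy] := eqVneq x.1 y.1; last by rewrite reduced_cons x1 xy.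
have [_|xy1] := eqVneq; first exact: reduced_behead rs.
case: s rs => [|z s]; rewrite ?reduced1 ?reduced_cons //=.
by rewrite xy1 xy => /and3P[_ -> ->].
Qed.

Lemma push_cons x s : reduced (x :: s) -> push x s = x :: s.
Proof.
case: s => [|y s]; first by rewrite /push reduced1 => /negPf ->.
by rewrite /push reduced_cons; case/and3P=> /negPf -> /negPf ->.
Qed.

Lemma push_one i s : push (i, 1) s = s.
Proof. by rewrite /push eqxx. Qed.

(** Van der Waerden's argument: each factor acts on normal forms through [push], which yields
    associativity of [smul]. *)
Lemma pushM i m m' s : reduced s ->
  push (i, m) (push (i, m') s) = push (i, m * m') s.
Proof.
move=> rs; have [->|m'1] := eqVneq m' 1; first by rewrite push_one mulg1.
have [->|m1] := eqVneq m 1; first by rewrite push_one mul1g.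
case: s rs => [|y s] rs.
  by rewrite /push /= (negPf m'1) /= (negPf m1) eqxx.
have [iy|iy] := eqVneq i y.1; last first.
  by rewrite /push /= (negPf m'1) (negPf iy) (negPf m1) /= eqxx.
rewrite {2}/push /= (negPf m'1) iy eqxx.
have [m'y1|m'y1] := eqVneq (m' * y.2) 1.
  have my : m' = y.2^-1 by rewrite -(mulgK y.2 m') m'y1 mul1g.
  (* Once [y] is cancelled, the next syllable lies in another factor, so nothing more reduces. *)
  have -> : push (y.1, m) s = (y.1, m) :: s.
    apply: push_cons; case: s rs => [|z s]; rewrite ?reduced1 ?reduced_cons //.
    by rewrite m1 => /and3P[_ -> ->].
  rewrite /push /= eqxx -mulgA m'y1 mulg1 (negPf m1).
  have [mm1|//] := eqVneq (m * m') 1.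
  have -> : m = y.2 by rewrite -(mulgK m' m) mm1 my mul1g invgK.
  by rewrite -surjective_pairing.
rewrite /push /= (negPf m1) eqxx mulgA.
have [mm1|mm1] := eqVneq (m * m') 1; last by [].
have y1 : y.2 != 1.
  by move: rs; case: (s) => [|z u]; rewrite ?reduced1 ?reduced_cons // => /and3P[].
by rewrite mm1 mul1g (negPf y1) -surjective_pairing.
Qed.

Definition smul s t := foldr push t s.
Definition sinv s := rev [seq (x.1, x.2^-1) | x <- s].

Lemma smul_reduced s t : reduced t -> reduced (smul s t).
Proof. by move=> rt; elim: s => //= x s; exact: push_reduced. Qed.

Lemma smul_push x s t : reduced t -> smul (push x s) t = push x (smul s t).
Proof.
move=> rt; case: x => i m; rewrite {1}/push /=.
have [->|m1] := eqVneq m 1; first by rewrite push_one.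
case: s => [//|[j m'] s] /=; have [->|//] := eqVneq i j.
have [mm1|mm1] /= := eqVneq (m * m') 1; rewrite pushM ?smul_reduced //.
by rewrite mm1 push_one.
Qed.

Lemma smulA s t u : reduced u -> smul (smul s t) u = smul s (smul t u).
Proof. by move=> ru; elim: s => //= x s IHs; rewrite smul_push // IHs. Qed.

Lemma smul0 s : reduced s -> smul s [::] = s.
Proof.
elim: s => //= x s IHs rs; rewrite IHs ?(reduced_behead rs) //.
exact: push_cons.
Qed.

Lemma smul_cat s t : reduced (s ++ t) -> smul s t = s ++ t.
Proof.
elim: s => //= x s IHs rs; rewrite IHs ?(reduced_behead rs) //.
exact: push_cons.
Qed.

Lemma sinv_reduced s : reduced s -> reduced (sinv s).
Proof.
case/andP=> s1 ss; apply/andP; split.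
  by rewrite /sinv all_rev all_map; under eq_all do rewrite /= invg_eq1.
rewrite /sinv rev_sorted sorted_map.
by under eq_sorted => x y do rewrite /= /adj /= eq_sym.
Qed.

Lemma smulVs s t : reduced (s ++ t) -> smul (sinv s) (s ++ t) = t.
Proof.
elim: s => // x s IHs rs; rewrite /sinv /= rev_cons /smul -cats1 foldr_cat /=.
have rst := reduced_behead rs.
have -> : push (x.1, x.2^-1) (x :: s ++ t) = s ++ t.
  rewrite -(push_cons rs) [x in push x (s ++ t)]surjective_pairing pushM //.
  by rewrite mulVg push_one.
exact: IHs.
Qed.

(** The elements are the normal forms themselves, so equality in the free product is equality of
    words. *)
Record freeprod := Freeprod { fword :> seq (I * M); fwordP : reduced fword }.
HB.instance Definition _ := [isSub for fword].
HB.instance Definition _ := [Choice of freeprod by <:].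
Implicit Types p q : freeprod.

Definition freeprod_one : freeprod := @Freeprod [::] erefl.
Definition freeprod_mul p q := Freeprod (smul_reduced p (fwordP q)).
Definition freeprod_inv p := Freeprod (sinv_reduced (fwordP p)).

Fact freeprod_mulA : associative freeprod_mul.
Proof. by move=> p q r; apply: val_inj; rewrite /= smulA //; case: r. Qed.

Fact freeprod_mul1 : left_id freeprod_one freeprod_mul.
Proof. by move=> p; exact: val_inj. Qed.

Fact freeprod_mulr1 : right_id freeprod_one freeprod_mul.
Proof. by move=> p; apply: val_inj; rewrite /= smul0 //; case: p. Qed.

Fact freeprod_mulV : left_inverse freeprod_one freeprod_inv freeprod_mul.
Proof.
move=> [s rs]; apply: val_inj => /=.
by rewrite -[s in smul _ s]cats0 smulVs ?cats0.
Qed.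

Fact freeprod_invK : involutive freeprod_inv.
Proof.
move=> p; apply: val_inj; rewrite /= /sinv map_rev revK -map_comp -[RHS]map_id.
by apply: eq_map => -[i m] /=; rewrite invgK.
Qed.

Fact freeprod_mulrV : right_inverse freeprod_one freeprod_inv freeprod_mul.
Proof. by move=> p; rewrite -{1}(freeprod_invK p) freeprod_mulV. Qed.

HB.instance Definition _ := isGroup.Build freeprod freeprod_mulA
  freeprod_mul1 freeprod_mulr1 freeprod_mulV freeprod_mulrV.

Lemma fwordM p q : fword (p * q) = smul p q. Proof. by []. Qed.
Lemma fwordV p : fword p^-1 = sinv p. Proof. by []. Qed.
Lemma fword_inj : injective fword. Proof. exact: val_inj. Qed.

Definition syl i m : freeprod := Freeprod (@push_reduced (i, m) [::] erefl).

Lemma sylM i : {morph syl i : m m' / m * m'}.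
Proof.
move=> m m'; apply: val_inj; rewrite /= -[push (i, m * m') _]pushM //.
by rewrite [push (i, m) [::]]/push /=; case: eqVneq => [->|] //=; rewrite push_one.
Qed.

Lemma syl1 i : syl i 1 = 1.
Proof. exact: (morph_one (sylM i)). Qed.

Lemma freeprodE p : p = foldr (fun x q => syl x.1 x.2 * q) 1 p.
Proof.
case: p => s rs; apply: val_inj => /=; elim: s rs => //= x s IHs rs.
rewrite -IHs ?(reduced_behead rs) //= -(push_cons rs) {1 2}(surjective_pairing x).
rewrite [push _ [::]]/push /=; case: eqVneq => [->|] //=; by rewrite push_one.
Qed.

Lemma freeprod_ind (Q : freeprod -> Prop) :
  Q 1 -> (forall p q, Q p -> Q q -> Q (p * q)) -> (forall i m, Q (syl i m)) ->
  forall p, Q p.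
Proof.
move=> Q1 QM Qi p; rewrite (freeprodE p); elim: (fword p) => //= x s IHs.
exact: QM.
Qed.

End FreeProduct.

Lemma is_subgroupP (G : groupType) (K : set G) :
  is_subgroup K <-> [/\ K 1, forall x y, K x -> K y -> K (x * y)
                      & forall x, K x -> K x^-1].
Proof.
rewrite /is_subgroup; split=> [KG|[K1 KM KV]].
  have KV := group_closedV KG; have KM := group_closedM KG.
  case: KG => /set_mem K1 _; split=> [//|x y /mem_set Kx /mem_set Ky|x].
    exact/set_mem/KM.
  by move=> /mem_set Kx; exact/set_mem/KV.
split=> [|x y /set_mem Kx /set_mem Ky]; apply/mem_set => //.
by apply: KM => //; exact: KV.
Qed.

Section Extension.
Variables (I : choiceType) (M L : groupType) (f : I -> M -> L).
Hypothesis fM : forall i, {morph f i : m m' / m * m'}.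

Definition fext (p : freeprod I M) : L := foldr (fun x y => f x.1 x.2 * y) 1 p.

Lemma fextM : {morph fext : p q / p * q}.
Proof.
pose ev := foldr (fun x y => f x.1 x.2 * y) 1.
have push_ev x s : ev (push x s) = f x.1 x.2 * ev s.
  rewrite /push; have [->|_] := eqVneq; first by rewrite (morph_one (@fM _)) mul1g.
  case: s => [//|y s]; have [xy|//] := eqVneq x.1 y.1.
  rewrite [ev (_ :: s)]/= mulgA -xy -fM; have [->|//] := eqVneq.
  by rewrite (morph_one (@fM _)) mul1g.
move=> p q; rewrite /fext fwordM -!/ev; elim: (fword p) => [|x s IHs] /=.
  by rewrite mul1g.
by rewrite push_ev IHs mulgA.
Qed.

Lemma fext_syl i m : fext (syl i m) = f i m.
Proof.
rewrite /fext /= /push /=; have [->|] /= := eqVneq.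
  by rewrite (morph_one (@fM _)).
by rewrite mulg1.
Qed.

End Extension.

Lemma freeprod_hom_eq (I : choiceType) (M L : groupType)
    (f h : freeprod I M -> L) :
  {morph f : p q / p * q} -> {morph h : p q / p * q} ->
  (forall i m, f (syl i m) = h (syl i m)) -> f =1 h.
Proof.
move=> fM hM fh; apply: freeprod_ind => // [|p q fp fq].
  by rewrite (morph_one fM) (morph_one hM).
by rewrite fM hM fp fq.
Qed.

Section FactorwiseMaps.
Variables (I : choiceType) (M : groupType) (u : I -> M -> M).
Hypothesis uM : forall i, {morph u i : m m' / m * m'}.

Definition fmap : freeprod I M -> freeprod I M := fext (fun i m => syl i (u i m)).

Fact fmap_factorM i : {morph (fun m => syl i (u i m)) : m m' / m * m'}.
Proof. by move=> m m'; rewrite uM sylM. Qed.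

Lemma fmapM : {morph fmap : p q / p * q}.
Proof. exact: fextM fmap_factorM. Qed.

Lemma fmap_syl i m : fmap (syl i m) = syl i (u i m).
Proof. exact: (fext_syl fmap_factorM). Qed.

Hypothesis u_inj : forall i, injective (u i).

(** Injective factor maps keep syllables nontrivial, so the image word needs no reduction. *)
Lemma fmap_word p : fword (fmap p) = [seq (x.1, u x.1 x.2) | x <- p].
Proof.
have uN1 i m : m != 1 -> u i m != 1.
  by apply: contra_neq => um; apply: (@u_inj i); rewrite um (morph_one (@uM _)).
case: p => s rs /=; rewrite /fmap /fext /=; elim: s rs => //= x s IHs rs.
rewrite {}IHs ?(reduced_behead rs) //=.
have x1 : x.2 != 1 by case/andP: rs => /andP[].
rewrite [push _ [::]]/push /= (negPf (uN1 _ _ x1)) /=; apply: push_cons.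
case: s rs => [|y s]; first by rewrite !reduced1 /= uN1.
move=> rs; case/andP: (rs) => rs1 rss; apply/andP; split.
  by rewrite -map_cons all_map; apply: sub_all rs1 => z; exact: uN1.
by rewrite -!map_cons sorted_map.
Qed.

(** As [fmap] acts on normal forms letter by letter, a fixed element is a product of fixed
    syllables. *)
Lemma fmap_fixed_ind (Q : freeprod I M -> Prop) :
  Q 1 -> (forall p q, Q p -> Q q -> Q (p * q)) ->
  (forall i m, u i m = m -> Q (syl i m)) ->
  forall p, fmap p = p -> Q p.
Proof.
move=> Q1 QM Qi p up; have := fmap_word p; rewrite up => E.
rewrite (freeprodE p); elim: (fword p) E => //= -[i m] s IHs /= [um us].
apply: (QM _ _ _ (IHs us)).
by apply: Qi; rewrite -um.
Qed.

End FactorwiseMaps.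

(** * Centralizers in free products *)

Section Centralizer.
Variables (I : choiceType) (M : groupType).
Implicit Types (x : I * M) (s t : seq (I * M)) (p q : freeprod I M).

Lemma size_push x s : size (push x s) <= (size s).+1.
Proof.
rewrite /push; case: ifP => // _; case: s => //= y s.
by do 2?[case: ifP => //= _]; rewrite leqW.
Qed.

Lemma size_push_eq x s : size (push x s) = (size s).+1 -> push x s = x :: s.
Proof.
rewrite /push; case: ifP => [_|_]; first lia.
case: s => //= y s; case: ifP => //= _; case: ifP => //= _ /=; lia.
Qed.

Lemma size_smul s t : size (smul s t) <= size s + size t.
Proof. by elim: s => //= x s IHs; have := size_push x (smul s t); lia. Qed.

Lemma size_smul_eq s t :
  size (smul s t) = (size s + size t)%N -> smul s t = s ++ t.
Proof.
elim: s => //= x s IHs; have := size_push x (smul s t).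
have := size_smul s t => le1 le2 eq1.
have eq2 : size (smul s t) = (size s + size t)%N by lia.
by rewrite -IHs // size_push_eq //; lia.
Qed.

Lemma reduced_cat x y s t : (last x s).1 != y.1 ->
  reduced (x :: s) -> reduced (y :: t) -> reduced ((x :: s) ++ y :: t).
Proof.
move=> xy /andP[/= /andP[x1 s1] xs] /andP[/= /andP[y1 t1] yt].
by rewrite /reduced /= all_cat /= cat_path /= x1 s1 y1 t1 xs yt /adj xy.
Qed.

Lemma reduced_catr s t : reduced (s ++ t) -> reduced t.
Proof. by elim: s => //= x s IHs /reduced_behead. Qed.

(* If p V and V p are equal words, then either V is a prefix of p, or p is a
   prefix of V = p u = u p, and then p and u start with the same syllable. *)
Lemma commute_prefix p (V : freeprod I M) : p != 1 -> V != 1 -> uniq V ->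
  reduced (p ++ V) -> p * V = V * p ->
  exists2 q, p = V * q & size q < size p.
Proof.
move=> p1 V1 uV rpV pV.
have [p_gt0 V_gt0] : 0 < size p /\ 0 < size V.
  by rewrite !lt0n !size_eq0; split; [move: p1|move: V1]; apply: contra_neq;
    move=> w0; apply: fword_inj.
have pVE : fword (p * V) = p ++ V by rewrite fwordM smul_cat.
(* The same element has full length as [p V], so no cancellation or merging takes place in [V p]
   either. *)
have VpE : fword (V * p) = V ++ p.
  by rewrite fwordM size_smul_eq // -fwordM -pV pVE size_cat addnC.
have {pVE VpE}E : p ++ V = V ++ p :> seq _ by rewrite -pVE pV.
have [le_Vp|lt_pV] := leqP (size V) (size p).
  have pE : p = V ++ drop (size V) p :> seq _.
    rewrite -[LHS](cat_take_drop (size V)); congr (_ ++ _).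
    by rewrite -(takel_cat V le_Vp) E take_size_cat.
  have rq : reduced (drop (size V) p).
    by apply: (@reduced_catr V); rewrite -pE; exact: fwordP.
  exists (Freeprod rq); last by rewrite /= size_drop; lia.
  apply: fword_inj; rewrite fwordM /= smul_cat -?pE //; exact: fwordP.
have VE : V = p ++ drop (size p) V :> seq _.
  rewrite -[LHS](cat_take_drop (size p)); congr (_ ++ _).
  by rewrite -(takel_cat p (ltnW lt_pV)) -E take_size_cat.
have u_gt0 : 0 < size (drop (size p) V) by rewrite size_drop; lia.
move: uV E; rewrite VE; set u := drop _ _ in u_gt0 *.
rewrite -catA => uV /eqP; rewrite eqseq_cat // eqxx /= => /eqP.
move: uV; case: (fword p) p_gt0 => // x s _; case: u u_gt0 => // y t _.
by rewrite cat_uniq /= => /and3P[_ /norP[xy _] _] [yx]; rewrite yx inE eqxx in xy.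
Qed.

(** [V] begins and ends in different factors, so a nontrivial [p] can be followed without reduction
    by [V] or by its inverse, depending on its last syllable. The prefix lemma then strips [V] or
    [V^-1] from [p], and induction on the length applies. Thus the centralizer of [V] is generated
    by [V]. *)
Lemma commute_subgroup (V : freeprod I M) (K : set (freeprod I M)) x s :
  fword V = x :: s -> (last x s).1 != x.1 -> uniq V ->
  is_subgroup K -> K V -> forall p, p * V = V * p -> K p.
Proof.
move=> VE ls uV /is_subgroupP[K1 KM KV] KVV p.
have V1 : V != 1 by apply/eqP => V1; move: VE; rewrite V1.
have VVE : fword V^-1 = sinv (x :: s) by rewrite fwordV VE.
have [y [t [VVt yE tE]]] : exists y t,
    [/\ fword V^-1 = y :: t, y.1 = (last x s).1 & True].
  rewrite VVE lastI /sinv map_rcons rev_rcons.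
  by exists ((last x s).1, (last x s).2^-1); eexists; split.
have uVV : uniq V^-1.
  rewrite fwordV rev_uniq map_inj_uniq // => -[i m] [j m'] /= [-> mm'].
  by rewrite (invg_inj mm').
have [n] := ubnP (size p); elim: n p => // n IHn p ltpn pV.
have [->//|p1] := eqVneq p 1.
have [a [w pE]] : exists a w, fword p = a :: w.
  case pE: (fword p) => [|a w]; last by exists a, w.
  by case/eqP: p1; exact: fword_inj.
have rp := fwordP p; have rV := fwordP V; have rVV := fwordP V^-1.
have [aw|aw] := eqVneq (last a w).1 x.1.
  have pVV : p * V^-1 = V^-1 * p.
    by apply: (@mulgI _ V); rewrite mulgA -pV mulgK mulVKg.
  have [||q pq lt_qp] := commute_prefix p1 _ uVV _ pVV.
  - by rewrite invg_eq1.
  - rewrite pE VVt; apply: reduced_cat; rewrite -?pE -?VVt //.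
    by rewrite yE aw eq_sym.
  rewrite pq; apply: KM; first exact: KV.
  apply: IHn; first lia.
  apply: (@mulgI _ V^-1); rewrite mulgA -pq pV.
  by rewrite [in LHS]pq mulgA mulgV mul1g mulKg.
have [|q pq lt_qp] := commute_prefix p1 V1 uV _ pV.
  by rewrite pE VE; apply: reduced_cat; rewrite -?pE -?VE.
rewrite pq; apply: KM => //; apply: IHn; first lia.
by apply: (@mulgI _ V); rewrite mulgA -pq pV.
Qed.

End Centralizer.

(** * Groups given by generators and relators *)

Section WordEvaluation.
Variables (T : Type) (L : groupType).
Implicit Types (f : T -> L) (w : word T).

Definition weval f w : L :=
  foldr (fun l x => (if l.2 then (f l.1)^-1 else f l.1) * x) 1 w.

Lemma weval_cat f u v : weval f (u ++ v) = weval f u * weval f v.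
Proof. by elim: u => [|l u IHu] /=; rewrite ?mul1g // IHu mulgA. Qed.

Lemma eq_weval f h : f =1 h -> weval f =1 weval h.
Proof. by move=> fh; elim=> //= l w ->; rewrite fh. Qed.

End WordEvaluation.

Lemma morph_weval (T : Type) (L L' : groupType) (h : L -> L') (f : T -> L) w :
  {morph h : x y / x * y} -> h (weval f w) = weval (h \o f) w.
Proof.
move=> hM; elim: w => [|[t b] w IHw] /=; first exact: morph_one.
by rewrite hM IHw; case: b; rewrite ?(morph_inv hM).
Qed.

Section PresentedGroup.
Variables (T : choiceType) (rels : set (word T)).
Local Notation P := (presented rels).

Definition pgen (t : T) : P := class_of_word rels [:: (t, false)].

Lemma class_weval w : class_of_word rels w = weval pgen w.
Proof.
elim: w => [//|[t b] w IHw]; rewrite -cat1s class_of_word_cat IHw /=.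
congr (_ * _); case: b => //.
by rewrite -[RHS]/(presented_inv _) -class_of_word_inv.
Qed.

Lemma pgen_rel r : rels r -> weval pgen r = 1.
Proof. by move=> rr; rewrite -class_weval; apply/class_of_wordP/word_eq_rel. Qed.

Lemma presented_ind (Q : P -> Prop) : Q 1 ->
  (forall x y, Q x -> Q y -> Q (x * y)) -> (forall x, Q x -> Q x^-1) ->
  (forall t, Q (pgen t)) -> forall x, Q x.
Proof.
move=> Q1 QM QV Qg x; rewrite -(class_of_repr x) class_weval.
by elim: (repr x) => //= -[t b] w IHw; apply: (QM) => //=; case: b; first apply: QV.
Qed.

Variables (L : groupType) (f : T -> L).
Hypothesis f_rel : forall r, rels r -> weval f r = 1.

Definition phom (x : P) : L := weval f (repr x).

Lemma weval_word_eq u v : word_eq rels u v -> weval f u = weval f v.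
Proof.
elim=> [//|u' v' _ -> //|u' v' w _ -> _ ->//|u' u2 v' v2 _ E1 _ E2|t b|r /f_rel //].
  by rewrite !weval_cat E1 E2.
by case: b; rewrite /= mulg1 ?mulgV ?mulVg.
Qed.

Lemma phom_class w : phom (class_of_word rels w) = weval f w.
Proof. exact/weval_word_eq/repr_class. Qed.

Lemma phomM : {morph phom : x y / x * y}.
Proof.
move=> x y; rewrite -(class_of_repr x) -(class_of_repr y).
by rewrite -[_ * _]class_of_word_cat !phom_class weval_cat.
Qed.

Lemma phom_pgen t : phom (pgen t) = f t.
Proof. by rewrite phom_class /= mulg1. Qed.

End PresentedGroup.

Lemma presented_hom_eq (T : choiceType) (rels : set (word T)) (L : groupType)
    (f h : presented rels -> L) :
  {morph f : x y / x * y} -> {morph h : x y / x * y} ->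
  (forall t, f (pgen rels t) = h (pgen rels t)) -> f =1 h.
Proof.
move=> fM hM fh; apply: presented_ind => // [|x y fx fy|x fx].
- by rewrite (morph_one fM) (morph_one hM).
- by rewrite fM hM fx fy.
- by rewrite (morph_inv fM) (morph_inv hM) fx.
Qed.

Lemma countable_presented (T : countType) (rels : set (word T)) :
  countable [set: presented rels].
Proof.
have -> : [set: presented rels] = range (class_of_word rels).
  apply/esym/seteqP; split=> // x _.
  by exists (repr x); rewrite ?class_of_repr.
exact: card_le_trans (card_image_le _ _) (countableP _).
Qed.

(** * Permutation groups and left translations *)

Section Symmetries.
Variable T : Type.

Record sym := Sym {
  sym_fun :> T -> T;
  sym_inv : T -> T;
  symK : cancel sym_fun sym_inv;
  symVK : cancel sym_inv sym_fun }.

Lemma sym_eqP (s t : sym) : sym_fun s =1 sym_fun t -> s = t.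
Proof.
case: s t => [f f' fK f'K] [h h' hK h'K] /= /funext fh; case: h / fh in hK h'K *.
have fh' : f' = h' by apply: funext => x; rewrite -{1}(h'K x) fK.
by case: h' / fh' in hK h'K *; congr Sym; exact: Prop_irrelevance.
Qed.

HB.instance Definition _ := gen_eqMixin sym.
HB.instance Definition _ := gen_choiceMixin sym.

Definition sym_one := @Sym id id (fun=> erefl) (fun=> erefl).
Definition sym_mul (s t : sym) :=
  Sym (can_comp (@symK s) (@symK t)) (can_comp (@symVK t) (@symVK s)).
Definition sym_opp (s : sym) := Sym (@symVK s) (@symK s).

Fact sym_mulA : associative sym_mul.
Proof. by move=> s t u; exact: sym_eqP. Qed.
Fact sym_mul1 : left_id sym_one sym_mul.
Proof. by move=> s; exact: sym_eqP. Qed.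
Fact sym_mulr1 : right_id sym_one sym_mul.
Proof. by move=> s; exact: sym_eqP. Qed.
Fact sym_mulV : left_inverse sym_one sym_opp sym_mul.
Proof. by move=> s; apply: sym_eqP => x /=; exact: symK. Qed.
Fact sym_mulrV : right_inverse sym_one sym_opp sym_mul.
Proof. by move=> s; apply: sym_eqP => x /=; exact: symVK. Qed.

HB.instance Definition _ := isGroup.Build sym sym_mulA
  sym_mul1 sym_mulr1 sym_mulV sym_mulrV.

Lemma symM (s t : sym) x : (s * t) x = s (t x). Proof. by []. Qed.

End Symmetries.

Section LeftTranslations.
Variable G : groupType.

Definition ltrans (x : G) : sym G := Sym (mulKg x) (mulVKg x).

Lemma ltransM : {morph ltrans : x y / x * y}.
Proof. by move=> x y; apply: sym_eqP => z /=; rewrite mulgA. Qed.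

End LeftTranslations.

(** * Free groups as free products of infinite cyclic groups *)

Section FreeProductOfIntegers.
Variable I : choiceType.
Local Notation F := (freeprod I Zmul).

Definition fgen (i : I) : F := @syl I Zmul i (1%R : int).

Lemma syl_zpow i (n : Zmul) : syl i n = zpow (fgen i) n :> F.
Proof.
have sylD (m m' : int) :
      @syl I Zmul i (m + m')%R = @syl I Zmul i m * @syl I Zmul i m'.
  exact: sylM.
elim/int_rect: n => [|n IHn|n IHn].
- exact: (@syl1 _ Zmul).
- by rewrite -add1n PoszD zpowS sylD IHn.
- apply: (@mulgI _ (fgen i)); rewrite -sylD -zpowS.
  by have -> : (1 + - n.+1%:Z = - n%:Z)%R by lia.
Qed.

Lemma fgen_ind (Q : F -> Prop) : Q 1 ->
  (forall x y, Q x -> Q y -> Q (x * y)) -> (forall x, Q x -> Q x^-1) ->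
  (forall i, Q (fgen i)) -> forall x, Q x.
Proof.
move=> Q1 QM QV Qg; apply: freeprod_ind => // i n; rewrite syl_zpow.
have QX m : Q (fgen i ^+ m) by elim: m => // m IHm; rewrite expgS; exact: QM.
by case: n => n /=; [exact: QX | exact/QV/QX].
Qed.

Lemma fgen_hom_eq (L : groupType) (f h : F -> L) :
  {morph f : x y / x * y} -> {morph h : x y / x * y} ->
  (forall i, f (fgen i) = h (fgen i)) -> f =1 h.
Proof.
move=> fM hM fh; apply: fgen_ind => // [|x y fx fy|x fx].
- by rewrite (morph_one fM) (morph_one hM).
- by rewrite fM hM fx fy.
- by rewrite (morph_inv fM) (morph_inv hM) fx.
Qed.

Variables (L : groupType) (f : I -> L).

Definition zext : F -> L := fext (fun i (n : Zmul) => zpow (f i) n).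

Lemma zextM : {morph zext : x y / x * y}.
Proof. by apply: fextM => i m n; exact: zpowD. Qed.

Lemma zext_fgen i : zext (fgen i) = f i.
Proof. by rewrite /zext fext_syl // => j m n; exact: zpowD. Qed.

End FreeProductOfIntegers.

(** * Ranks of subgroups *)

Local Open Scope card_scope.

Section Generation.
Variable G : groupType.
Implicit Types (S K L : set G).

Lemma generatesP S K : generates S K <->
  [/\ is_subgroup K, S `<=` K & forall L, is_subgroup L -> S `<=` L -> K `<=` L].
Proof.
split=> [<-|[Kg SK Kmin]]; last first.
  by apply/seteqP; split; [exact: smallest_sub | move=> x Kx L [Lg /Kmin]; exact].
split=> [||L Lg SL]; [|exact: sub_gen_smallest|exact: smallest_sub].
apply/is_subgroupP; split.
- by move=> L [/is_subgroupP[]].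
- move=> x y Sx Sy L [Lg SL]; have /is_subgroupP[_ LM _] := Lg.
  by apply: LM; [exact: Sx | exact: Sy].
- move=> x Sx L [Lg SL]; have /is_subgroupP[_ _ LV] := Lg.
  by apply: LV; exact: Sx.
Qed.

Lemma generates_id K : is_subgroup K -> generates K K.
Proof. by move=> Kg; apply/generatesP; split. Qed.

Lemma has_card_inj T U (A : set T) (B : set U) c d :
  A #= B -> has_card A c -> has_card B d -> c = d.
Proof.
move=> AB; have cAB : countable A <-> countable B by rewrite (eq_countable AB).
case: c => [n||]; case: d => [m||] //= cA cB.
- congr FinCard; apply/card_eq_II; apply: card_eq_trans cB.
  by apply: card_eq_trans AB; rewrite card_eq_sym.
- case: infinite_nat; apply/finite_setP; exists n.
  apply: card_eq_trans cA; rewrite card_eq_sym.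
  exact: card_eq_trans AB cB.
- by case: cB; apply/cAB/finite_set_countable/finite_setP; exists n.
- case: infinite_nat; apply/finite_setP; exists m.
  apply: card_eq_trans cB; apply: card_eq_trans AB.
  by rewrite card_eq_sym.
- by case: cB; apply/cAB; move: cA => /card_eqPle[].
- by case: cA; apply/cAB/finite_set_countable/finite_setP; exists m.
- by case: cA; apply/cAB; move: cB => /card_eqPle[].
Qed.

Lemma is_rank_rk K c : is_rank K c -> rk K = c.
Proof.
move=> Kc; apply: xget_unique => // d [S' [S'K S'd S'min]].
case: Kc => S [SK Sc Smin]; apply: has_card_inj S'd Sc.
by apply/card_eqPle; split; [exact: S'min | exact: Smin].
Qed.

Lemma is_rank_aleph0 K : is_subgroup K -> countable K ->
  (forall S, generates S K -> infinite_set S) -> is_rank K Aleph0.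
Proof.
move=> Kg Kc Kinf; have KK := generates_id Kg.
have natK S : generates S K -> [set: nat] #<= S by move=> /Kinf/infiniteP.
exists K; split=> //= [|S SK]; first by apply/card_eqPle; split=> //; exact: natK.
exact: card_le_trans Kc (natK _ SK).
Qed.

Lemma countable_rank K : is_subgroup K -> countable K ->
  (exists n, is_rank K (FinCard n)) \/ is_rank K Aleph0.
Proof.
move=> Kg Kc.
have [[n Kn]|Kinf] := pselect (exists n S, generates S K /\ S #= `I_n).
  left; pose P n := `[< exists S, generates S K /\ S #= `I_n >].
  have exP : exists n, P n by exists n; apply/asboolP.
  case: (ex_minnP exP) => m /asboolP[S [SK Sm]] mP; exists m, S; split=> // S' S'K.
  have [/finite_setP[m' S'm']|/infiniteP infS'] := pselect (finite_set S').
    rewrite (card_le_eql Sm) (card_le_eqr S'm') card_le_II mP //.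
    by apply/asboolP; exists S'.
  apply: card_le_trans infS'; apply: finite_set_countable.
  by apply/finite_setP; exists m.
right; apply: is_rank_aleph0 => // S SK /finite_setP[n Sn]; apply: Kinf.
by exists n, S.
Qed.

(* Fewer than N generators would satisfy a linear relation killed by all N
   characters, which their dual elements do not. *)
Lemma card_generators_ge N (chi : 'I_N -> G -> rat) (k : 'I_N -> G) K S :
  (forall i x y, K x -> K y -> chi i (x * y) = (chi i x + chi i y)%R) ->
  (forall j, K (k j)) -> (forall i j, chi i (k j) = (i == j)%:R%R) ->
  generates S K -> `I_N #<= S.
Proof.
move=> chiM Kk chik /generatesP[Kg SK Kmin].
have /is_subgroupP[K1 KM KV] := Kg.
have [/finite_seqP[s Ss]|/infiniteP natS] := pselect (finite_set S); last first.
  by apply: card_le_trans natS; exact: finite_set_countable.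
pose t := undup s; have St x : S x <-> x \in t by rewrite Ss mem_undup.
have tS : `I_(size t) #<= S.
  have inj_t : {in `I_(size t) &, injective (nth 1 t)}.
    move=> i j; rewrite !inE => it jt /eqP.
    by rewrite nth_uniq ?undup_uniq // => /eqP.
  have := inj_card_eq inj_t; rewrite card_eq_sym => /card_eqPle[tI _].
  apply: card_le_trans tI _; apply: subset_card_le => _ [i it <-].
  by apply/St; rewrite mem_nth.
apply: card_le_trans tS; rewrite card_le_II leqNgt; apply/negP => lt_tN.
pose A := (\matrix_(i < N, j < size t) chi i (tnth (in_tuple t) j))%R.
have : kermx A != 0%R.
  by rewrite kermx_eq0 /row_free neq_ltn (leq_ltn_trans (rank_leq_col A)).
case/rowV0Pn=> v /sub_kermxP vA /eqP; apply; apply/rowP => j0; rewrite mxE.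
pose lam x := (\sum_i v ord0 i * chi i x)%R.
have lamM x y : K x -> K y -> lam (x * y) = (lam x + lam y)%R.
  move=> Kx Ky; rewrite /lam -big_split /=; apply: eq_bigr => i _.
  by rewrite chiM // mulrDr.
have lam1 : lam 1 = 0%R.
  have := lamM 1 1 K1 K1; rewrite mulg1 => /eqP.
  by rewrite -subr_eq0 opprD addNKr oppr_eq0 => /eqP.
(* The kernel of [lam] in [K] contains [S], hence is all of [K]; at [k j0] the value of [lam] is the
   coordinate [v ord0 j0]. *)
have LG : is_subgroup [set x | K x /\ lam x = 0%R].
  apply/is_subgroupP; split=> [//|x y [Kx lx] [Ky ly]|x [Kx lx]] /=.
    by split; [exact: KM | rewrite lamM // lx ly addr0].
  split; first exact: KV.
  by have := lamM x _ Kx (KV _ Kx); rewrite mulgV lam1 lx add0r.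
have [|_] := Kmin _ LG _ (k j0) (Kk j0).
  move=> x Sx; split; first exact: SK.
  have /tnthP[j ->] : x \in in_tuple t by apply/St.
  have /rowP/(_ j) := vA; rewrite !mxE => vAj; rewrite -[RHS]vAj.
  by apply: eq_bigr => i _; rewrite mxE.
rewrite /lam (bigD1 j0) //= chik eqxx mulr1 big1 ?addr0 // => i ij.
by rewrite chik (negPf ij) mulr0.
Qed.

(** The dual characters make [k] injective and keep every generating set at [N] elements or more;
    [range k] attains this bound. *)
Lemma is_rank_fin N (chi : 'I_N -> G -> rat) (k : 'I_N -> G) K :
  (forall i x y, K x -> K y -> chi i (x * y) = (chi i x + chi i y)%R) ->
  (forall i j, chi i (k j) = (i == j)%:R%R) ->
  generates (range k) K -> is_rank K (FinCard N).
Proof.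
move=> chiM chik kK; have /generatesP[_ Kk _] := kK.
have kI : range k #= `I_N.
  have inj_k : {in [set: 'I_N] &, injective k}.
    move=> i j _ _ kij; have := chik i j; rewrite -kij chik eqxx.
    by case: eqVneq => // _ /eqP; rewrite oner_eq0.
  apply: card_eq_trans (inj_card_eq inj_k) _; rewrite card_eq_sym.
  exact: card_II.
exists (range k); split=> // S SK; rewrite (card_le_eql kI).
by apply: card_generators_ge chiM _ chik SK => j; apply: Kk; exists j.
Qed.

Lemma generates_image K L (f : G -> G) S : is_subgroup L ->
  set_bij K L f -> {in K &, {morph f : x y / x * y}} ->
  generates S K -> generates (f @` S) L.
Proof.
move=> Lg [fK finj fsurj] fM /generatesP[Kg SK Kmin].
have /is_subgroupP[K1 KM KV] := Kg.
have {}fM x y : K x -> K y -> f (x * y) = f x * f y.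
  by move=> Kx Ky; apply: fM; rewrite inE.
have f1 : f 1 = 1 by apply: (@mulgI _ (f 1)); rewrite -fM // !mulg1.
apply/generatesP; split=> //.
  by move=> _ [x Sx <-]; apply/fK/SK.
move=> M /is_subgroupP[M1 MM MV] SM y /fsurj[x Kx <-].
(* Since [f] is controlled on [K] only, the preimage of [M] is taken inside [K]. *)
have Kg' : is_subgroup [set x | K x /\ M (f x)].
  apply/is_subgroupP; split=> [|a b [Ka Ma] [Kb Mb]|a [Ka Ma]] /=.
  - by rewrite f1.
  - by rewrite fM //; split; [exact: KM | exact: MM].
  - split; first exact: KV.
    suff -> : f a^-1 = (f a)^-1 by exact: MV.
    by apply: (@mulgI _ (f a)); rewrite -fM ?mulgV //; exact: KV.
have [|_ //] := Kmin _ Kg' _ x Kx.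
by move=> a Sa; split; [exact: SK | apply: SM; exists a].
Qed.

Lemma sub_isog_rank_le K L m n : is_subgroup L -> sub_isog K L ->
  is_rank K (FinCard m) -> is_rank L (FinCard n) -> (n <= m)%N.
Proof.
move=> Lg [f [fbij fM]] [S [SK Sm _]] [S' [S'L S'n S'min]].
rewrite -card_le_II -(card_le_eql S'n) -(card_le_eqr Sm).
apply: card_le_trans (S'min _ (generates_image Lg fbij fM SK)) _.
exact: card_image_le.
Qed.

Lemma sub_isog_refl K : sub_isog K K.
Proof. by exists id; split=> //; split=> // x Kx; exists x. Qed.

(** Each class contains its own group, so equality of classes gives isomorphisms in both directions
    and two inequalities between the ranks. *)
Lemma iso_class_rank K L m n : is_subgroup K -> is_subgroup L ->
  iso_class K = iso_class L ->
  is_rank K (FinCard m) -> is_rank L (FinCard n) -> m = n.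
Proof.
move=> Kg Lg KL Km Ln; apply/eqP; rewrite eqn_leq; apply/andP; split.
  have [_ LK] : iso_class L K by rewrite -KL; split; last exact: sub_isog_refl.
  exact: sub_isog_rank_le LK Ln Km.
have [_ KL'] : iso_class K L by rewrite KL; split; last exact: sub_isog_refl.
exact: sub_isog_rank_le KL' Km Ln.
Qed.

Lemma Fix_subgroup (phi : G -> G) :
  {morph phi : x y / x * y} -> is_subgroup (Fix phi).
Proof.
move=> phiM; apply/is_subgroupP; rewrite /Fix; split=> /= [|x y fx fy|x fx].
- exact: morph_one.
- by rewrite phiM fx fy.
- by rewrite morph_inv // fx.
Qed.

End Generation.

Lemma multiplicative_of (G : groupType) (f : G -> G) :
  {morph f : x y / x * y} -> exists F : {multiplicative G -> G}, F = f :> (G -> G).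
Proof.
move=> fM; pose m := isMultiplicative.Build G G f fM.
pose F : {multiplicative G -> G} := HB.pack f m.
by exists F.
Qed.

(** It suffices to realise every countable cardinal: fixed subgroups of a countable group are
    countable, so no other rank occurs, and one automorphism for each finite rank gives pairwise
    distinct isomorphism classes. *)
Lemma rank_spectrum (G : groupType) : countable [set: G] ->
  (forall c, c <> Uncountable -> exists phi : G -> G,
    [/\ {morph phi : x y / x * y}, bijective phi & is_rank (Fix phi) c]) ->
  [set rk (Fix phi) | phi in @Aut_group G] =
    [set FinCard n | n in [set: nat]] `|` [set Aleph0] /\
  infinite_set [set iso_class (Fix phi) | phi in @Aut_group G].
Proof.
move=> Gc ranks.
have autP c : c <> Uncountable -> exists2 phi : {multiplicative G -> G},
    @Aut_group G phi & is_rank (Fix phi) c.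
  move=> /ranks[phi [phiM phi_bij phic]].
  have [F FE] := multiplicative_of phiM; exists F;
    by rewrite ?FE //= /Aut_group /= FE.
split.
  apply/seteqP; split=> [_ [phi _ <-]|c cP].
    have Fg : is_subgroup (Fix phi) by apply: Fix_subgroup; exact: gmulfM.
    have Fc : countable (Fix phi) by apply: sub_countable Gc; exact: card_leT.
    have [[n /is_rank_rk->]|/is_rank_rk->] := countable_rank Fg Fc; last by right.
    by left; exists n.
  have [|phi phiA /is_rank_rk <-] := autP c; last by exists phi.
  by case: cP => [[n _ <-]|->].
have [n|F FP] := @boolp.choice nat {multiplicative G -> G}
    (fun n phi => @Aut_group G phi /\ is_rank (Fix phi) (FinCard n)).
  by have [//|phi ? ?] := autP (FinCard n); exists phi.
apply: (@sub_infinite_set _ (range (fun n => iso_class (Fix (F n))))).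
  by move=> _ [n _ <-]; exists (F n) => //; case: (FP n).
apply/infiniteP.
have Finj : {in [set: nat] &, injective (fun n => iso_class (Fix (F n)))}.
  move=> m n _ _ mn; have [_ Fm] := FP m; have [_ Fn] := FP n.
  by apply: iso_class_rank mn Fm Fn; apply: Fix_subgroup; exact: gmulfM.
by have /card_eqPle[] := inj_card_eq Finj.
Qed.

(** * The free group of rank two and characters of its finite-index subgroups and of the kernel of
    the degree *)

Section FreeGroupOfRankTwo.

Definition F2 : groupType := freeprod bool Zmul.
Definition X : F2 := fgen true.
Definition Y : F2 := fgen false.

Local Open Scope ring_scope.

(** The exponent sum of [X]. *)
Definition Xdeg : F2 -> int := @zext bool Zmul (fun b => b%:Z).

Lemma XdegM f h : Xdeg (f * h)%g = Xdeg f + Xdeg h.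
Proof. exact: (@zextM bool Zmul). Qed.

Lemma XdegV f : Xdeg (f^-1)%g = - Xdeg f.
Proof. by apply: (addrI (Xdeg f)); rewrite -XdegM mulgV subrr. Qed.

Lemma Xdeg_X : Xdeg X = 1.
Proof. exact: (@zext_fgen bool Zmul). Qed.

Lemma Xdeg_Y : Xdeg Y = 0.
Proof. exact: (@zext_fgen bool Zmul). Qed.

Lemma Xdeg_Xn n : Xdeg (X ^+ n)%g = n%:Z.
Proof.
by elim: n => [//|n IHn]; rewrite expgS XdegM Xdeg_X IHn -PoszD.
Qed.

(* On the subgroup of words of X-degree divisible by n, the second coordinate
   is a character that counts the occurrences of X^-i Y X^i. *)
Section Count.
Variables n i : int.

(** At [n = 0] divisibility by [n] means being 0, so the same count serves the kernel of the
    degree. *)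
Definition hit (j : int) : int := (n %| j - i)%Z%:Z.

Fact XsymK : cancel (fun p : int * int => (p.1 + 1, p.2)) (fun p => (p.1 - 1, p.2)).
Proof. by case=> a b /=; rewrite addrK. Qed.
Fact XsymVK : cancel (fun p : int * int => (p.1 - 1, p.2)) (fun p => (p.1 + 1, p.2)).
Proof. by case=> a b /=; rewrite subrK. Qed.
Fact YsymK : cancel (fun p : int * int => (p.1, p.2 + hit p.1))
  (fun p => (p.1, p.2 - hit p.1)).
Proof. by case=> a b /=; rewrite addrK. Qed.
Fact YsymVK : cancel (fun p : int * int => (p.1, p.2 - hit p.1))
  (fun p => (p.1, p.2 + hit p.1)).
Proof. by case=> a b /=; rewrite subrK. Qed.

(** A count that depends on the position is encoded as an action: [X] moves the position, and [Y]
    increases the counter at positions congruent to [i] modulo [n]. *)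
Definition walk : F2 -> sym (int * int) :=
  zext (fun b => if b then Sym XsymK XsymVK else Sym YsymK YsymVK).

Lemma walkM f h p : walk (f * h)%g p = walk f (walk h p).
Proof. by rewrite [walk (f * h)%g]zextM. Qed.

Lemma walkV f p : walk f (walk (f^-1)%g p) = p.
Proof. by rewrite -walkM mulgV. Qed.

Lemma walkX p : walk X p = (p.1 + 1, p.2).
Proof. by rewrite /walk zext_fgen. Qed.

Lemma walkY p : walk Y p = (p.1, p.2 + hit p.1).
Proof. by rewrite /walk zext_fgen. Qed.

Lemma walkXn m p : walk (X ^+ m)%g p = (p.1 + m%:Z, p.2).
Proof.
elim: m p => [|m IHm] p; first by rewrite addr0; case: p.
by rewrite expgSr walkM walkX IHm /= -addrA -PoszD.
Qed.

(** [hit] has period [n] and ignores the counter. *)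
Lemma walk_shift f p d e : (n %| d)%Z ->
  walk f (p.1 + d, p.2 + e) = ((walk f p).1 + d, (walk f p).2 + e).
Proof.
move=> nd; move: f p d nd e; apply: fgen_ind => [|f h IHf IHh|f IHf|[]] p d nd e.
- by [].
- by rewrite !walkM IHh ?IHf.
- apply: (can_inj (@symK _ (walk f))); rewrite walkV.
  by have := IHf (walk (f^-1)%g p) _ nd e; rewrite walkV /= => ->.
- by rewrite !walkX /= addrAC.
- rewrite !walkY /= /hit; congr (_, _); rewrite addrAC; congr (_ + _ + _).
  by rewrite addrAC rpredDr.
Qed.

Lemma walk_deg f p : (walk f p).1 = p.1 + Xdeg f.
Proof.
move: f p; apply: fgen_ind => [|f h IHf IHh|f IHf|[]] p.
- by rewrite addr0.
- by rewrite walkM IHf IHh XdegM -addrA [Xdeg h + _]addrC.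
- by apply: (addIr (Xdeg f)); rewrite -IHf walkV XdegV subrK.
- by rewrite walkX Xdeg_X.
- by rewrite walkY Xdeg_Y addr0.
Qed.

Definition count_Y f : int := (walk f (0, 0)).2.

(** After [h] the position is a multiple of [n], from where [f] counts as it does from the
    origin. *)
Lemma count_YM f h : (n %| Xdeg h)%Z -> count_Y (f * h)%g = count_Y f + count_Y h.
Proof.
move=> nh; rewrite /count_Y walkM.
have := walk_shift f (0, 0) (walk h (0, 0)).2 nh; rewrite /= !add0r.
rewrite -[Xdeg h]add0r -[0 + Xdeg h](walk_deg h (0, 0)) -surjective_pairing.
by move=> ->.
Qed.

Lemma count_Y_Xn m : count_Y (X ^+ m)%g = 0.
Proof. by rewrite /count_Y walkXn. Qed.

(** The rightmost factor acts first: [X ^+ m] moves the origin to [m], [Y] counts there, and the way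
    back changes only the position. *)
Lemma count_Y_conj (m : nat) : count_Y (Y ^ (X ^+ m))%g = (n %| m%:Z - i)%Z%:Z.
Proof.
rewrite /count_Y conjgE walkM.
have -> q : walk (X ^+ m)^-1%g q = (q.1 - m%:Z, q.2).
  apply: (can_inj (@symK _ (walk (X ^+ m)%g))); rewrite walkV walkXn /= subrK.
  by case: q.
by rewrite walkM walkXn walkY /= !add0r.
Qed.

End Count.

Lemma Xdeg_conj m : Xdeg (Y ^ (X ^+ m))%g = 0.
Proof. by rewrite conjgE !XdegM XdegV Xdeg_Y add0r addNr. Qed.

End FreeGroupOfRankTwo.

(** * Automorphisms of H * Z^k *)

Section ShearedVectors.
Variables (k : nat) (n : int).
Local Open Scope ring_scope.
Implicit Types (x : int) (v : 'rV[int]_k.+2).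

(* The linear part A is invertible over the integers, and
   det (1 - A) = 2 ^ k * n. *)
Definition shearv x v : 'rV[int]_k.+2 :=
  \row_j if j == 0 then (2 - n) * v 0 0 - v 0 1 + x
         else if j == 1 then v 0 0 else - v 0 j.

Definition unshearv x v : 'rV[int]_k.+2 :=
  \row_j if j == 0 then v 0 1
         else if j == 1 then (2 - n) * v 0 1 + x - v 0 0 else - v 0 j.

Definition diagv (m : int) : 'rV[int]_k.+2 :=
  \row_(j < k.+2) if (j < 2)%N then m else 0.

Lemma shearvD x y v w : shearv (x + y) (v + w) = shearv x v + shearv y w.
Proof.
have E (a b a' b' : int) : (2 - n) * (a + b) - (a' + b') + (x + y) =
    ((2 - n) * a - a' + x) + ((2 - n) * b - b' + y) by lia.
apply/rowP => j; rewrite !mxE; case: ifP => _; first exact: E.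
by case: ifP => // _; exact: opprD.
Qed.

Lemma shearvK x : cancel (shearv x) (unshearv x).
Proof.
move=> v; apply/rowP => j; rewrite !mxE /=; case: eqVneq => [->//|j0].
by case: eqVneq => [->|_]; lia.
Qed.

Lemma unshearvK x : cancel (unshearv x) (shearv x).
Proof.
move=> v; apply/rowP => j; rewrite !mxE /=; case: eqVneq => [->|j0]; first by lia.
by case: eqVneq => [->//|_]; lia.
Qed.

Lemma diagvD a b : diagv (a + b) = diagv a + diagv b.
Proof. by apply/rowP => j; rewrite !mxE; case: ifP. Qed.

Lemma diagvE m : diagv m 0 0 = m.
Proof. by rewrite mxE. Qed.

(** Row 1 equates the first two coordinates, the rows after it force 2 v_j = 0, and row 0 then reads
    n m = x. *)
Lemma shearv_fixed x v : shearv x v = v <-> exists2 m, v = diagv m & n * m = x.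
Proof.
have small (j : 'I_k.+2) : (j < 2)%N = (j == 0) || (j == 1).
  by case: j => -[|[|j]].
split=> [/rowP vE|[m -> <-]].
  have v0 := vE 0; have v1 := vE 1; rewrite !mxE /= in v0 v1.
  exists (v 0 0); last by lia.
  apply/rowP => j; rewrite !mxE small; have := vE j; rewrite !mxE.
  have [->//|j0] := eqVneq j 0; have [->//|j1] := eqVneq j 1.
  by rewrite /=; lia.
apply/rowP => j; rewrite !mxE /= small.
have [_|j0] := eqVneq j 0; first by rewrite /=; lia.
by have [_|j1] := eqVneq j 1; rewrite /= ?oppr0.
Qed.

End ShearedVectors.

Section ShearAutomorphisms.
Variables (H : groupType) (k : nat).
Local Notation G := (dprod_group H (free_abelian_group k.+2)).
Local Open Scope ring_scope.

Definition vec (p : G) : 'rV[int]_k.+2 := p.2.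
Definition pt (h : H) (v : 'rV[int]_k.+2) : G := (h, v).

Lemma pt_eq (p q : G) : p.1 = q.1 -> vec p = vec q -> p = q.
Proof. by case: p q => [h v] [h' v'] /= -> ->. Qed.

Lemma vecM (p q : G) : vec (p * q)%g = vec p + vec q. Proof. by []. Qed.

Lemma countable_dprod : countable [set: H] -> countable [set: G].
Proof.
move=> Hc; have -> : [set: G] = [set: H] `*` [set: free_abelian_group k.+2].
  by apply/seteqP; split.
apply: countableX => //; exact: countableP [set: 'rV[int]_k.+2].
Qed.

Variables (c : H -> int) (n : int).
Hypothesis cM : forall x y, c (x * y)%g = c x + c y.

Definition shear (psi : H -> H) (p : G) : G :=
  pt (psi p.1) (shearv n (c p.1) (vec p)).

Lemma shearM psi : {morph psi : x y / (x * y)%g} ->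
  {morph shear psi : p q / (p * q)%g}.
Proof.
move=> psiM p q; apply: (congr2 pt (psiM _ _)).
by rewrite vecM -[RHS]shearvD -cM.
Qed.

Lemma shear_bij psi : bijective psi -> bijective (shear psi).
Proof.
case=> psi' psiK psi'K.
exists (fun p => pt (psi' p.1) (unshearv n (c (psi' p.1)) (vec p))) => -[h v];
  apply: pt_eq; rewrite /= ?psiK ?psi'K //.
  exact: shearvK.
exact: unshearvK.
Qed.

Lemma Fix_shear psi p : Fix (shear psi) p <->
  psi p.1 = p.1 /\ exists2 m, vec p = diagv k m & n * m = c p.1.
Proof.
rewrite -shearv_fixed; case: p => h v; split; first by case.
by case=> [/= hE vE]; apply: pt_eq.
Qed.

End ShearAutomorphisms.

(** What the construction asks of [H]: a free retract of rank two that is the fixed subgroup of one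
    automorphism, and another automorphism without nontrivial fixed points. *)
Definition has_fixed_retract (H : groupType) : Prop :=
  exists (iota : F2 -> H) (rho : H -> F2) (psi0 psi1 : H -> H),
    [/\ [/\ {morph iota : x y / x * y}, {morph rho : x y / x * y}
          & cancel iota rho],
        [/\ {morph psi0 : x y / x * y}, bijective psi0
          & forall h, psi0 h = h -> h = 1]
      & [/\ {morph psi1 : x y / x * y}, bijective psi1
          & Fix psi1 = range iota]].

(** * Realising each rank by a sheared automorphism *)

Section FixedRanks.
Variables (H : groupType) (k : nat).
Variables (iota : F2 -> H) (rho : H -> F2) (psi0 psi1 : H -> H).
Hypotheses (iotaM : {morph iota : x y / x * y})
  (rhoM : {morph rho : x y / x * y}) (iotaK : cancel iota rho).
Hypotheses (psi0M : {morph psi0 : x y / x * y})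
  (psi1M : {morph psi1 : x y / x * y}).
Hypotheses (Fix0 : forall h, psi0 h = h -> h = 1) (Fix1 : Fix psi1 = range iota).
Local Notation G := (dprod_group H (free_abelian_group k.+2)).
Local Open Scope ring_scope.

Let c (h : H) : int := Xdeg (rho h).

Fact degM x y : c (x * y)%g = c x + c y.
Proof. by rewrite /c rhoM XdegM. Qed.

Fact deg1 : c 1%g = 0.
Proof. by rewrite /c (morph_one rhoM). Qed.

Fact Fix1P n p : Fix (shear (k := k) c n psi1) p <->
  exists2 f, p.1 = iota f & exists2 m, vec p = diagv k m & n * m = Xdeg f.
Proof.
rewrite Fix_shear; split=> [[pE [m vE mE]]|[f fE [m vE mE]]].
  have [f _ fE] : range iota p.1 by rewrite -Fix1.
  by exists f => //; exists m => //; rewrite mE -fE /c iotaK.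
split; last by exists m => //; rewrite mE fE /c iotaK.
by rewrite -[_ = _]/(Fix psi1 p.1) Fix1; exists f.
Qed.

Lemma is_rank0 : is_rank (Fix (shear (k := k) c 1 psi0)) (FinCard 0).
Proof.
pose k0 (i : 'I_0) : G := 1%g.
have Fg : is_subgroup (Fix (shear (k := k) c 1 psi0)).
  by apply: Fix_subgroup; apply: shearM => //; exact: degM.
apply: (@is_rank_fin _ 0 (fun i p => 0) k0) => [[] //|[] //|].
apply/generatesP; split=> // [_ [[] //]|L /is_subgroupP[L1 _ _] _ p].
move/Fix_shear => [/Fix0 p1 [m vE]]; rewrite mul1r p1 deg1 => m0.
suff -> : p = 1%g by [].
apply: pt_eq => //; rewrite vE m0.
by apply/rowP => j; rewrite !mxE; case: ifP.
Qed.

Lemma is_rank1 : is_rank (Fix (shear (k := k) c 0 psi0)) (FinCard 1).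
Proof.
have Fg : is_subgroup (Fix (shear (k := k) c 0 psi0)).
  by apply: Fix_subgroup; apply: shearM => //; exact: degM.
pose e : G := pt 1%g (diagv k 1).
(* For [n = 0] the integer [m] is unconstrained, and the coordinate [vec p 0 0] reads it off. *)
apply: (@is_rank_fin _ 1 (fun i p => (vec p 0 0)%:~R) (fun=> e)).
- by move=> i x y _ _; rewrite vecM mxE rmorphD.
- by move=> i j; rewrite !ord1 /vec /= diagvE.
apply/generatesP; split=> // [_ [_ _ <-]|L /is_subgroupP[L1 LM LV] eL p].
  apply/Fix_shear; split; first exact: morph_one.
  by exists 1 => //; rewrite mul0r deg1.
move/Fix_shear => [/Fix0 p1 [m vE _]].
have Le : L e by apply: eL; exists ord0.
have -> : p = zpow e m.
  have -> : p = pt 1%g (diagv k m) by exact: pt_eq.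
  elim/int_rect: m {vE} => [|m IHm|m IHm].
  - by apply: pt_eq => //; apply/rowP => j; rewrite !mxE; case: ifP.
  - have -> : m.+1%:Z = 1 + m%:Z by lia.
    rewrite zpowS -IHm diagvD.
    by apply: pt_eq => //=; rewrite mul1g.
  - apply: (@mulgI _ e); rewrite -zpowS.
    have -> : 1 + - m.+1%:Z = - m%:Z by lia.
    rewrite -IHm; apply: pt_eq; first by rewrite /= mulg1.
    by rewrite -[LHS]diagvD; congr (diagv _ _); lia.
have LX i : L (e ^+ i)%g by elim: i => // i IHi; rewrite expgS; exact: LM.
by case: m {vE} => i /=; [exact: LX | exact/LV/LX].
Qed.

(** The conjugate has [X]-degree 0, so with the zero vector it is fixed whatever [n] is. *)
Definition conjpt (j : nat) : G := pt (iota (Y ^ (X ^+ j))%g) 0.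

Fact Fix_conjpt n j : Fix (shear (k := k) c n psi1) (conjpt j).
Proof.
apply/Fix1P; exists (Y ^ (X ^+ j))%g => //; exists 0; rewrite ?mulr0 ?Xdeg_conj //.
by apply/rowP => i; rewrite !mxE; case: ifP.
Qed.

Fact count_Fix n i x y : Fix (shear (k := k) c n psi1) x ->
  Fix (shear (k := k) c n psi1) y ->
  count_Y n i (rho (x * y)%g.1) = count_Y n i (rho x.1) + count_Y n i (rho y.1).
Proof.
move=> _ /Fix1P[f yE [m _ mE]]; rewrite [rho _]rhoM count_YM //.
by rewrite yE iotaK -mE dvdz_mulr.
Qed.

Fact count_conjpt n i j :
  count_Y n i (rho (conjpt j).1) = (n %| j%:Z - i)%Z%:Z.
Proof. by rewrite /conjpt /= iotaK count_Y_conj. Qed.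

Lemma is_rank_infinite : countable [set: H] ->
  is_rank (Fix (shear (k := k) c 0 psi1)) Aleph0.
Proof.
move=> Hc; have Fg : is_subgroup (Fix (shear (k := k) c 0 psi1)).
  by apply: Fix_subgroup; apply: shearM => //; exact: degM.
apply: is_rank_aleph0 => //.
  apply: (@sub_countable _ _ _ [set: G]); first exact: card_leT.
  exact: countable_dprod.
move=> S SF /finite_setP[N SN].
(* One character more than the supposed number of generators; for [n = 0] the count at [i] is
   nonzero on [conjpt j] only if [j = i]. *)
have := @card_generators_ge _ N.+1
  (fun i p => (count_Y 0 i%:Z (rho p.1))%:~R) (fun j => conjpt j) _ S.
move=> /(_ (Fix (shear (k := k) c 0 psi1))).
rewrite (card_le_eqr SN) card_le_II ltnn => H0; suff : false by [].
apply: H0 => //.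
- by move=> i x y Fx Fy; rewrite count_Fix // rmorphD.
- by move=> j; exact: Fix_conjpt.
- move=> i j; rewrite count_conjpt dvd0z subr_eq0 eqz_nat eq_sym.
  by rewrite -pmulrn.
Qed.

Section FiniteIndex.
Variable n : nat.
Let psi := shear (k := k) c n.+1 psi1.
Let top : G := pt (iota (X ^+ n.+1)%g) (diagv k 1).

Fact Fix_top : Fix psi top.
Proof.
apply/Fix1P; exists (X ^+ n.+1)%g => //; exists 1 => //.
by rewrite mulr1 Xdeg_Xn.
Qed.

(* The powers X^-r with r <= n represent the cosets of X-degree divisible by
   n + 1 in F2, and every generator of F2 permutes these cosets. *)
Fact coset_representatives (L : set G) : is_subgroup L -> L top ->
  (forall j : nat, (j <= n)%N -> L (conjpt j)) ->
  forall f, exists s, [/\ L s, Fix psi s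
    & exists2 r, (r <= n)%N & iota f = (s.1 * iota (X ^- r))%g].
Proof.
move=> /is_subgroupP[L1 LM LV] Ltop Lconj.
have /is_subgroupP[F1 FM FV] : is_subgroup (Fix psi).
  by apply: Fix_subgroup; apply: shearM => //; exact: degM.
pose V f := exists s, [/\ L s, Fix psi s
  & exists2 r, (r <= n)%N & iota f = (s.1 * iota (X ^- r))%g].
have iV := morph_inv iotaM.
have VX f : V f -> V (f * X)%g.
  (* At [r = 0] the coset wraps around: X = X^(n+1) X^-n, and [top] absorbs the first factor. *)
  case=> s [Ls Fs [[|r] rn fE]].
    exists (s * top)%g; split; [exact: LM | exact: FM Fix_top|].
    exists n => //; rewrite iotaM fE invg1 (morph_one iotaM) mulg1 /=.
    by rewrite -mulgA -iotaM expgS mulgK.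
  exists s; split=> //; exists r; first exact: ltnW.
  by rewrite iotaM fE -mulgA -iotaM expgS invgM mulgVK.
have VX' f : V f -> V (f * X^-1)%g.
  case=> s [Ls Fs [r rn fE]]; have {rn} := rn; rewrite leq_eqVlt => /predU1P[rn|rn].
    exists (s * top^-1)%g; split; [exact/LM/LV | exact/FM/FV/Fix_top|].
    exists 0%N => //; rewrite iotaM fE rn invg1 (morph_one iotaM) mulg1 /=.
    by rewrite -mulgA -iotaM -invgM -expgS iV.
  exists s; split=> //; exists r.+1 => //.
  by rewrite iotaM fE -mulgA -iotaM -invgM expgS.
(* X^-r Y = (X^-r Y X^r) X^-r, so the coset does not change and [conjpt r] is absorbed. *)
have VY f : V f -> V (f * Y)%g.
  case=> s [Ls Fs [r rn fE]]; exists (s * conjpt r)%g.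
  split; [exact/LM/Lconj | exact/FM/Fix_conjpt | exists r => //].
  by rewrite iotaM fE -!mulgA /= -!iotaM conjgE -!mulgA mulgV mulg1.
have VY' f : V f -> V (f * Y^-1)%g.
  case=> s [Ls Fs [r rn fE]]; exists (s * (conjpt r)^-1)%g.
  split; [exact/LM/LV/Lconj | exact/FM/FV/Fix_conjpt | exists r => //].
  rewrite iotaM fE -!mulgA /= -iV -!iotaM conjgE !invgM invgK -!mulgA.
  by rewrite mulgV mulg1.
(* Both signs are treated together so that the induction passes to inverses. *)
suff VM f : (forall h, V h -> V (h * f)%g) /\ (forall h, V h -> V (h * f^-1)%g).
  move=> f; rewrite -[f]mul1g; apply: (VM f).1; exists 1%g.
  by split=> //; exists 0%N; rewrite // -invg1 /= mul1g.
move: f; apply: fgen_ind => [|f h [Vf Vf'] [Vh Vh']|f [Vf Vf']|[]].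
- by split=> h; rewrite ?invg1 mulg1.
- by split=> u Vu; rewrite ?invgM mulgA; [apply/Vh/Vf | apply/Vf'/Vh'].
- by split=> h; rewrite ?invgK; [exact: Vf' | exact: Vf].
- by [].
- by [].
Qed.

(** Index [n.+1] yields [n.+2] Schreier generators, [conjpt 0] to [conjpt n] and [top]. The counts
    modulo [n.+1] are dual to the former and vanish on [top]; the vector coordinate is dual to
    [top]. *)
Lemma is_rank_finite_index : is_rank (Fix psi) (FinCard n.+2).
Proof.
have Fg : is_subgroup (Fix psi).
  by apply: Fix_subgroup; apply: shearM => //; exact: degM.
pose gen (j : 'I_n.+2) : G := if (j <= n)%N then conjpt j else top.
pose chi (i : 'I_n.+2) (p : G) : rat :=
  if (i <= n)%N then (count_Y n.+1 i%:Z (rho p.1))%:~R else (vec p 0 0)%:~R.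
apply: (@is_rank_fin _ _ chi gen).
- move=> i x y Fx Fy; rewrite /chi; case: ifP => _.
    by rewrite count_Fix // rmorphD.
  by rewrite vecM mxE rmorphD.
- have maxE (j : 'I_n.+2) : (j <= n)%N = false -> j = ord_max.
    by move=> jn; apply: val_inj => /=; have := ltn_ord j; lia.
  move=> i j; rewrite /chi /gen; case: (boolP (i <= n)%N) => [ilen|/negbTE/maxE ->];
    case: (boolP (j <= n)%N) => [jlen|/negbTE/maxE ->].
  + rewrite count_conjpt -eqz_mod_dvd !modz_small; try lia.
    by rewrite eqz_nat eq_sym -pmulrn.
  + rewrite /= iotaK count_Y_Xn; case: eqVneq => // ij.
    by move: ilen; rewrite ij /= ltnn.
  + rewrite /vec /= mxE; case: eqVneq => // ij.
    by move: jlen; rewrite -ij /= ltnn.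
  + by rewrite eqxx /vec /= diagvE.
apply/generatesP; split=> // [_ [j _ <-]|L Lg genL p Fp].
  by rewrite /gen; case: ifP => _; [exact: Fix_conjpt | exact: Fix_top].
have Ltop : L top by apply: genL; exists ord_max; rewrite // /gen /= ltnn.
have Lconj j : (j <= n)%N -> L (conjpt j).
  move=> jn; apply: genL; exists (inord j) => //.
  by rewrite /gen inordK ?jn // ltnS leqW.
have /Fix1P[f pE [m vE mE]] := Fp.
have [s [Ls Fs [r rn fE]]] := coset_representatives Lg Ltop Lconj f.
have /Fix1P[h sE [m' vE' mE']] := Fs.
have fhE : f = (h * X ^- r)%g.
  by apply: (can_inj iotaK); rewrite fE sE iotaM.
(* [p] and [s] are fixed, so the degrees of [f] and [h] are multiples of [n.+1]; they differ by [r],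
   which is at most [n]. *)
have r0 : r = 0%N.
  have rE : r%:Z = n.+1%:Z * (m' - m).
    by rewrite mulrBr mE mE' fhE XdegM XdegV Xdeg_Xn; lia.
  have [d0|d1] := lerP (m' - m) 0.
    suff : r%:Z <= 0 by lia.
    by rewrite rE mulr_ge0_le0.
  suff : n.+1%:Z <= r%:Z by lia.
  by rewrite rE ler_peMr //; lia.
suff -> : p = s by [].
apply: pt_eq; first by rewrite pE fE r0 invg1 (morph_one iotaM) mulg1.
rewrite vE vE'; congr diagv; apply: (@mulfI _ n.+1%:Z) => //.
by rewrite mE mE' fhE r0 invg1 mulg1.
Qed.

End FiniteIndex.

End FixedRanks.

Lemma fixed_ranks (H : groupType) (k : nat) : countable [set: H] ->
  has_fixed_retract H -> forall c, c <> Uncountable ->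
  exists phi : dprod_group H (free_abelian_group k.+2) ->
               dprod_group H (free_abelian_group k.+2),
    [/\ {morph phi : x y / x * y}, bijective phi & is_rank (Fix phi) c].
Proof.
move=> Hc [iota [rho [psi0 [psi1 [[iM rM ioK] [p0M p0b p0F] [p1M p1b p1F]]]]]].
pose phi n psi := shear (k := k) (fun h => Xdeg (rho h)) n psi.
have cD : forall x y, Xdeg (rho (x * y)) = (Xdeg (rho x) + Xdeg (rho y))%R.
  by move=> x y; rewrite rM XdegM.
case=> [[|[|n]]||] // _.
- exists (phi 1%R psi0); split; [exact: shearM | exact: shear_bij|].
  exact: (is_rank0 k rM p0M p0F).
- exists (phi 0%R psi0); split; [exact: shearM | exact: shear_bij|].
  exact: (is_rank1 k rM p0M p0F).
- exists (phi n.+1%:Z%R psi1); split; [exact: shearM | exact: shear_bij|].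
  exact: (is_rank_finite_index k iM rM ioK p1M p1F n).
- exists (phi 0%R psi1); split; [exact: shearM | exact: shear_bij|].
  exact: (is_rank_infinite k rM ioK p1M p1F Hc).
Qed.

(** * Free groups *)

Lemma zpow_subgroup (G : groupType) (K : set G) (x : G) n :
  is_subgroup K -> K x -> K (zpow x n).
Proof.
move=> /is_subgroupP[K1 KM KV] Kx.
have KX m : K (x ^+ m) by elim: m => // m IHm; rewrite expgS; exact: KM.
by case: n => n /=; [exact: KX | exact/KV/KX].
Qed.

Lemma image_subgroup (G H : groupType) (f : G -> H) :
  {morph f : u v / u * v} -> is_subgroup (range f).
Proof.
move=> fM; apply/is_subgroupP; split.
- by exists 1; rewrite // (morph_one fM).
- by move=> _ _ [u _ <-] [v _ <-]; exists (u * v); rewrite // fM.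
- by move=> _ [u _ <-]; exists u^-1; rewrite // (morph_inv fM).
Qed.

Section SignChanges.
Variables (I : choiceType) (e : I -> bool).
Local Notation F := (freeprod I Zmul).

Definition sign_change : F -> F :=
  zext (fun i => if e i then fgen i else (fgen i)^-1).

(** A sign change acts on each infinite cyclic factor separately, and negation of integers fixes
    only 0; so the fixed syllables are powers of the generators that are kept. *)
Lemma sign_change_fixed (K : set F) p : is_subgroup K ->
  (forall i, e i -> K (fgen i)) -> sign_change p = p -> K p.
Proof.
move=> Kg Ke; have /is_subgroupP[K1 KM _] := Kg.
pose u i (m : Zmul) : Zmul := if e i then m else m^-1.
have uM i : {morph u i : m m' / m * m'}.
  by rewrite /u; case: (e i) => m m' //; exact: opprD.
have uI i : injective (u i).
  by rewrite /u; case: (e i) => m m' //; exact: invg_inj.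
have -> : sign_change p = fmap u p.
  apply: fgen_hom_eq => [||i]; [exact: zextM | exact: fmapM|].
  rewrite /sign_change zext_fgen fmap_syl // /u; case: (e i) => //.
  by rewrite -(morph_inv (@sylM I Zmul i)).
apply: fmap_fixed_ind => // i m; rewrite /u; case: ifP => [ei _|_ mm].
  by rewrite syl_zpow; apply: zpow_subgroup => //; exact: Ke.
suff -> : m = 1 by rewrite syl1.
by have : (- (m : int) = m)%R := mm;
  change ((- (m : int) = m)%R -> (m : int) = 0%R); lia.
Qed.

End SignChanges.

Section FreeGroups.
Variable g : nat.
Local Notation F := (free_group g.+2).
Let x (t : 'I_g.+2) : F := pgen set0 t.

Fact no_relation (L : groupType) (f : 'I_g.+2 -> L) r :
  @set0 (word 'I_g.+2) r -> weval f r = 1.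
Proof. by []. Qed.

Let hom (L : groupType) (f : 'I_g.+2 -> L) : F -> L := phom f.

Fact homM (L : groupType) (f : 'I_g.+2 -> L) : {morph hom f : u v / u * v}.
Proof. exact/phomM/no_relation. Qed.

Fact homE (L : groupType) (f : 'I_g.+2 -> L) t : hom f (x t) = f t.
Proof. exact/phom_pgen/no_relation. Qed.

Let inv_outside (e : 'I_g.+2 -> bool) : F -> F :=
  hom (fun t => if e t then x t else (x t)^-1).

Fact inv_outsideM e : {morph inv_outside e : u v / u * v}.
Proof. exact: homM. Qed.

Fact inv_outsideE e t : inv_outside e (x t) = if e t then x t else (x t)^-1.
Proof. exact: homE. Qed.

Fact inv_outsideK e : involutive (inv_outside e).
Proof.
have M := inv_outsideM e.
apply: presented_hom_eq => // [u v|t]; first by rewrite !M.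
rewrite -/(x t) inv_outsideE; case: ifP => et; first by rewrite inv_outsideE et.
by rewrite (morph_inv M) inv_outsideE et invgK.
Qed.

Fact inv_outside_bij e : bijective (inv_outside e).
Proof. by exists (inv_outside e); exact: inv_outsideK. Qed.

(** [Phi] and [Psi] pass between the presentation and normal forms, where [inv_outside] becomes
    [sign_change]. *)
Fact inv_outside_fixed (e : 'I_g.+2 -> bool) (K : set F) h : is_subgroup K ->
  (forall t, e t -> K (x t)) -> inv_outside e h = h -> K h.
Proof.
move=> /is_subgroupP[K1 KM KV] Ke fixh.
pose Phi : F -> freeprod 'I_g.+2 Zmul := hom (@fgen _).
pose Psi : freeprod 'I_g.+2 Zmul -> F := zext x.
have PsiM : {morph Psi : u v / u * v} by exact: zextM.
have PhiM : {morph Phi : u v / u * v} by exact: homM.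
have PhiK : cancel Phi Psi.
  apply: presented_hom_eq => // [u v|t]; first by rewrite PhiM PsiM.
  by rewrite -/(x t) /Phi homE /Psi zext_fgen.
have PhiE u : Phi (inv_outside e u) = sign_change e (Phi u).
  move: u; apply: presented_hom_eq => [u v|u v|t].
  - by rewrite inv_outsideM PhiM.
  - by rewrite PhiM [LHS]zextM.
  rewrite -/(x t) inv_outsideE {2}/Phi homE /sign_change zext_fgen.
  by case: (e t); rewrite ?(morph_inv PhiM) /Phi homE.
rewrite -(PhiK h); apply: (@sign_change_fixed _ e (Psi @^-1` K)).
- apply/is_subgroupP; split=> /= [|u v Ku Kv|u Ku].
  + by rewrite (morph_one PsiM).
  + by rewrite PsiM; exact: KM.
  + by rewrite (morph_inv PsiM); exact: KV.
- by move=> t et; rewrite /= /Psi zext_fgen; exact: Ke.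
- by rewrite -PhiE fixh.
Qed.

Lemma free_group_fixed_retract : has_fixed_retract F.
Proof.
pose iota : F2 -> F :=
  @zext bool F (fun b => if b then x ord0 else x (lift ord0 ord0)).
pose two (t : 'I_g.+2) := (t == ord0) || (t == lift ord0 ord0).
have iotaM : {morph iota : u v / u * v} by exact: zextM.
have iotaX : iota X = x ord0 by rewrite /iota zext_fgen.
have iotaY : iota Y = x (lift ord0 ord0) by rewrite /iota zext_fgen.
exists iota, (hom (fun t => if t == ord0 then X else
                           if t == lift ord0 ord0 then Y else 1)),
  (inv_outside xpred0), (inv_outside two); split; split=> //.
- exact: homM.
- apply: fgen_hom_eq => // [u v|[]]; first by rewrite iotaM homM.
    by rewrite -/X iotaX homE.
  by rewrite -/Y iotaY homE.
- exact: inv_outsideM.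
- exact: inv_outside_bij.
- move=> h; apply: (@inv_outside_fixed xpred0 [set 1]) => //.
  apply/is_subgroupP; split=> // [_ _ -> ->|_ ->]; first by rewrite /= mulg1.
  by rewrite /= invg1.
- exact: inv_outsideM.
- exact: inv_outside_bij.
- apply/seteqP; split=> [h|_ [u _ <-]].
    apply: inv_outside_fixed; first exact: image_subgroup.
    by move=> t /orP[] /eqP ->; [exists X | exists Y].
  rewrite /Fix /=; move: u; apply: fgen_hom_eq => // [u v|b].
    by rewrite iotaM inv_outsideM.
  by case: b; rewrite ?iotaX ?iotaY -/X -/Y ?iotaX ?iotaY inv_outsideE.
Qed.

End FreeGroups.

(** * Surface groups *)

Section SurfaceRelator.

Definition handle (g : nat) (i : 'I_g) : word ('I_g + 'I_g)%type :=
  [:: (inl i, false); (inr i, false); (inl i, true); (inr i, true)].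

Definition sgen (g : nat) (L : groupType) (p q : L) (f : 'I_g + 'I_g -> L)
    (t : 'I_g.+1 + 'I_g.+1) : L :=
  match t with
  | inl i => if unlift ord0 i is Some k then f (inl k) else p
  | inr i => if unlift ord0 i is Some k then f (inr k) else q
  end.

Lemma weval_sgen g (L : groupType) (p q : L) (f : 'I_g + 'I_g -> L) :
  weval (sgen p q f) (surface_relator g.+1) =
  p * q * p^-1 * q^-1 * weval f (surface_relator g).
Proof.
rewrite /surface_relator enum_ordSl /= !unlift_none -!mulgA.
do 4!congr (_ * _); elim: (enum _) => //= i s IHs.
by rewrite !liftK -IHs.
Qed.

Lemma weval_one T (L : groupType) (w : word T) : weval (fun=> 1) w = 1 :> L.
Proof. by elim: w => //= -[t []] w /= ->; rewrite ?invg1 mulg1. Qed.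

Lemma surface_relator_uniq g : uniq (surface_relator g).
Proof.
have idx (s : seq 'I_g) (l : ('I_g + 'I_g) * bool) :
    l \in flatten [seq handle i | i <- s] ->
    (match l.1 with inl i => i | inr i => i end) \in s.
  elim: s => // i s IHs.
  have -> : flatten [seq handle j | j <- i :: s] =
            handle i ++ flatten [seq handle j | j <- s] by [].
  rewrite mem_cat [_ \in i :: s]inE => /orP[|/IHs ->]; last by rewrite orbT.
  by rewrite !inE => /or4P[] /eqP -> /=; rewrite eqxx.
rewrite /surface_relator -/(@handle g).
elim: (enum _) (enum_uniq 'I_g) => //= i s IHs /andP[iNs us].
have nin l : (match l.1 with inl j => j | inr j => j end) = i ->
    l \notin flatten [seq handle i | i <- s].
  by move=> li; apply: contra iNs => /idx; rewrite li.
rewrite !inE !negb_or !nin // IHs // andbT.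
by rewrite !xpair_eqE !andbF.
Qed.

Definition letter_syl g (l : ('I_g + 'I_g) * bool) : ('I_g + 'I_g) * Zmul :=
  (l.1, if l.2 then (-1)%R : int else 1%R : int).

(** Neighbouring letters alternate between [inl] and [inr]. *)
Lemma surface_syl_reduced g : reduced (map (@letter_syl g) (surface_relator g)).
Proof.
apply/andP; split; first by apply/allP => _ /mapP[[t []] _ ->].
rewrite /surface_relator; case: (enum _) => //= i s.
have pathP j (d : Zmul) : path (@adj _ _) (inr j, d)
    (map (@letter_syl g) (flatten [seq handle i | i <- s])).
  by elim: s j d => //= {}i s IHs j d; rewrite /adj /=; exact: IHs.
by rewrite /adj /=; exact: pathP.
Qed.

Definition surface_word g : freeprod ('I_g + 'I_g)%type Zmul :=
  weval (@fgen _) (surface_relator g).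

Lemma surface_wordE g :
  fword (surface_word g) = map (@letter_syl g) (surface_relator g).
Proof.
rewrite /surface_word; have := surface_syl_reduced g.
elim: (surface_relator g) => //= l w IHw rlw; rewrite -push_cons //.
rewrite -IHw ?(reduced_behead rlw) //.
by case: l {rlw} => t [].
Qed.

(** The relator begins in an [inl] factor, ends in an [inr] factor and repeats no signed letter, as
    the centralizer lemma asks. *)
Lemma commute_surface_word g (K : set (freeprod ('I_g.+1 + 'I_g.+1)%type Zmul)) p :
  is_subgroup K -> K (surface_word g.+1) ->
  p * surface_word g.+1 = surface_word g.+1 * p -> K p.
Proof.
move=> Kg Kw; have wE := surface_wordE g.+1.
have uw : uniq (surface_word g.+1).
  rewrite wE map_inj_uniq ?surface_relator_uniq // => -[t b] [t' b'] [-> /=].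
  by case: b b' => -[].
rewrite /surface_relator enum_ordSl /= in wE.
apply: (commute_subgroup wE) => //.
suff lastP (s : seq 'I_g.+1) j (d : Zmul) i : (last (inr j, d)
    (map (@letter_syl _) (flatten [seq handle i | i <- s]))).1 != inl i.
  exact: lastP.
by elim: s j d => //= {}i' s IHs j d; exact: IHs.
Qed.

End SurfaceRelator.

(** * Twists of a surface group and their fixed points *)

Section SurfaceGroups.
Variable g : nat.
Local Notation T := ('I_g.+1 + 'I_g.+1)%type.
Local Notation H := (surface_group g.+2).

Definition sgen_of (t : 'I_g.+2 + 'I_g.+2) : H :=
  pgen [set surface_relator g.+2] t.
Definition lift_gen (k : T) : 'I_g.+2 + 'I_g.+2 :=
  match k with inl i => inl (lift ord0 i) | inr i => inr (lift ord0 i) end.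

Let a : H := sgen_of (inl ord0).
Let b : H := sgen_of (inr ord0).
Let z (k : T) : H := sgen_of (lift_gen k).

Fact sgen_ofE t : sgen_of t = sgen a b z t.
Proof.
case: t => i; case: (unliftP ord0 i) => [j|] -> /=;
  by rewrite ?liftK ?unlift_none.
Qed.

Section Homs.
Variables (L : groupType) (p q : L) (f : T -> L).

Definition shom : H -> L := phom (sgen p q f).

Hypothesis rel : p * q * p^-1 * q^-1 * weval f (surface_relator g.+1) = 1.

Fact shom_rel r : [set surface_relator g.+2] r -> weval (sgen p q f) r = 1.
Proof. by move=> ->; rewrite weval_sgen. Qed.

Lemma shomM : {morph shom : x y / x * y}. Proof. exact/phomM/shom_rel. Qed.
Lemma shom_a : shom a = p.
Proof.
by rewrite /shom phom_pgen; [rewrite /= unlift_none | exact: shom_rel].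
Qed.
Lemma shom_b : shom b = q.
Proof.
by rewrite /shom phom_pgen; [rewrite /= unlift_none | exact: shom_rel].
Qed.
Lemma shom_z k : shom (z k) = f k.
Proof.
rewrite /shom phom_pgen; last exact: shom_rel.
by case: k => i; rewrite /= liftK.
Qed.
End Homs.

Lemma surface_ind (Q : H -> Prop) : Q 1 ->
  (forall x y, Q x -> Q y -> Q (x * y)) -> (forall x, Q x -> Q x^-1) ->
  Q a -> Q b -> (forall k, Q (z k)) -> forall h, Q h.
Proof.
move=> Q1 QM QV Qa Qb Qz; apply: presented_ind => // t.
rewrite -/(sgen_of t) sgen_ofE.
by case: t => i; case: (unliftP ord0 i) => [j|] -> /=;
  rewrite ?liftK ?unlift_none.
Qed.

Lemma surface_hom_eq (L : groupType) (f h : H -> L) :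
  {morph f : x y / x * y} -> {morph h : x y / x * y} ->
  f a = h a -> f b = h b -> (forall k, f (z k) = h (z k)) -> f =1 h.
Proof.
move=> fM hM fa fb fz; apply: surface_ind => // [|x y fx fy|x fx].
- by rewrite (morph_one fM) (morph_one hM).
- by rewrite fM hM fx fy.
- by rewrite (morph_inv fM) (morph_inv hM) fx.
Qed.

Let C : H := a * b * a^-1 * b^-1.
Local Notation W f := (weval f (surface_relator g.+1)).

Fact Wz : W z = C^-1.
Proof.
have : weval sgen_of (surface_relator g.+2) = 1 by exact: pgen_rel.
rewrite (eq_weval sgen_ofE) weval_sgen -/C => CW.
by rewrite -(mulKg C (W z)) CW mulg1.
Qed.

Let twist (p q v : H) : H -> H := shom p q (fun k => v * z k * v^-1).

(** Conjugation by [v] carries [C^-1], the product over the other handles, to the inverse of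
    [v C v^-1]. *)
Fact twist_rel p q v : p * q * p^-1 * q^-1 = v * C * v^-1 ->
  p * q * p^-1 * q^-1 * W (fun k => v * z k * v^-1) = 1.
Proof.
move=> ->; have conjM : {morph (fun x : H => v * x * v^-1) : x y / x * y}.
  by move=> x y; rewrite !mulgA mulgVK.
have -> : W (fun k => v * z k * v^-1) = v * W z * v^-1.
  by rewrite (morph_weval _ _ conjM).
by rewrite Wz !gnorm.
Qed.

Let psi1 := twist a b C.
Let psi1' := twist a b C^-1.
Let psi0 := twist a^-1 b^-1 (a^-1 * b^-1).

Fact psi1_rel : a * b * a^-1 * b^-1 * W (fun k => C * z k * C^-1) = 1.
Proof. by apply: (@twist_rel a b C); rewrite mulgK. Qed.
Fact psi1'_rel : a * b * a^-1 * b^-1 * W (fun k => C^-1 * z k * C^-1^-1) = 1.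
Proof. by apply: (@twist_rel a b C^-1); rewrite invgK mulVg mul1g. Qed.
(** For v = a^-1 b^-1, the conjugate v C v^-1 is a^-1 b^-1 a b, the commutator of a^-1 and b^-1. *)
Fact psi0_rel : a^-1 * b^-1 * a^-1^-1 * b^-1^-1 *
  W (fun k => a^-1 * b^-1 * z k * (a^-1 * b^-1)^-1) = 1.
Proof. by apply: (@twist_rel a^-1 b^-1 (a^-1 * b^-1)); rewrite /C !gnorm. Qed.

Fact psi1M : {morph psi1 : x y / x * y}. Proof. exact: shomM psi1_rel. Qed.
Fact psi1'M : {morph psi1' : x y / x * y}. Proof. exact: shomM psi1'_rel. Qed.
Fact psi0M : {morph psi0 : x y / x * y}. Proof. exact: shomM psi0_rel. Qed.

Fact psi1_a : psi1 a = a. Proof. exact: shom_a psi1_rel. Qed.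
Fact psi1_b : psi1 b = b. Proof. exact: shom_b psi1_rel. Qed.
Fact psi1_z k : psi1 (z k) = C * z k * C^-1. Proof. exact: (shom_z psi1_rel). Qed.
Fact psi1'_a : psi1' a = a. Proof. exact: shom_a psi1'_rel. Qed.
Fact psi1'_b : psi1' b = b. Proof. exact: shom_b psi1'_rel. Qed.
Fact psi1'_z k : psi1' (z k) = C^-1 * z k * C.
Proof. by rewrite [LHS](shom_z psi1'_rel) invgK. Qed.
Fact psi0_a : psi0 a = a^-1. Proof. exact: shom_a psi0_rel. Qed.
Fact psi0_b : psi0 b = b^-1. Proof. exact: shom_b psi0_rel. Qed.
Fact psi0_z k : psi0 (z k) = a^-1 * b^-1 * z k * (a^-1 * b^-1)^-1.
Proof. exact: (shom_z psi0_rel). Qed.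

Fact psi1_C : psi1 C = C.
Proof. by rewrite /C !psi1M !(morph_inv psi1M) psi1_a psi1_b. Qed.
Fact psi1'_C : psi1' C = C.
Proof. by rewrite /C !psi1'M !(morph_inv psi1'M) psi1'_a psi1'_b. Qed.

Fact psi1K : cancel psi1 psi1'.
Proof.
apply: surface_hom_eq => // [x y|||k]; rewrite ?psi1M ?psi1'M //.
- by rewrite psi1_a psi1'_a.
- by rewrite psi1_b psi1'_b.
- rewrite psi1_z 2!psi1'M (morph_inv psi1'M) psi1'_C psi1'_z.
  by rewrite !gnorm.
Qed.

Fact psi1'K : cancel psi1' psi1.
Proof.
apply: surface_hom_eq => // [x y|||k]; rewrite ?psi1'M ?psi1M //.
- by rewrite psi1'_a psi1_a.
- by rewrite psi1'_b psi1_b.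
- rewrite psi1'_z 2!psi1M (morph_inv psi1M) psi1_C psi1_z.
  by rewrite !gnorm.
Qed.

(** With v = a^-1 b^-1, applying [psi0] twice conjugates [z k] by [psi0 v * v], which is a b a^-1
    b^-1 = C. *)
Fact psi0_psi0 h : psi0 (psi0 h) = psi1 h.
Proof.
move: h; apply: surface_hom_eq => [x y|x y|||k]; rewrite ?psi0M ?psi1M //.
- by rewrite psi0_a (morph_inv psi0M) psi0_a psi1_a invgK.
- by rewrite psi0_b (morph_inv psi0M) psi0_b psi1_b invgK.
rewrite psi0_z !psi0M !(morph_inv psi0M) !psi0M !(morph_inv psi0M).
by rewrite psi0_a psi0_b psi0_z psi1_z /C !gnorm.
Qed.

Fact psi1_bij : bijective psi1.
Proof. by exists psi1'; [exact: psi1K | exact: psi1'K]. Qed.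

Fact psi0_bij : bijective psi0.
Proof.
(* [psi0] commutes with its square [psi1], so this composite inverts it on both sides. *)
exists (psi1' \o psi0) => h /=; first by rewrite psi0_psi0 psi1K.
apply: (can_inj psi1K).
by rewrite -[LHS]psi0_psi0 (psi0_psi0 (psi1' _)) psi1'K psi0_psi0.
Qed.

(* The kernel of H -> Z, a -> 1, b, z_k -> 0, is the free product of <b> and
   the conjugates by a^j of the subgroup of the z_k. We only use that H acts on
   a free product Pr of copies of the free group B on the z_k, the copy Some j
   standing for the conjugate by a^j, and every beta k, in the copy None, for
   b. There conjugation by a becomes theta, because a b a^-1 = R^-1 b, and psi1
   becomes tau, which acts syllable by syllable. *)
Let B : groupType := freeprod T Zmul.
Let Pr : groupType := freeprod (option int) B.
Let R : B := surface_word g.+1.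
Let beta (k : T) : Pr := syl None (fgen k : B).
Let copy (j : int) : B -> Pr := syl (Some j).

Fact copyM j : {morph copy j : x y / x * y}. Proof. exact: sylM. Qed.

Fact Pr_hom_eq (L : groupType) (f h : Pr -> L) :
  {morph f : x y / x * y} -> {morph h : x y / x * y} ->
  (forall k, f (beta k) = h (beta k)) ->
  (forall j m, f (copy j m) = h (copy j m)) -> f =1 h.
Proof.
move=> fM hM fb fs; apply: freeprod_hom_eq => // -[j|] m; first exact: fs.
move: m; apply: fgen_hom_eq => // x y; first by rewrite sylM fM.
by rewrite sylM hM.
Qed.

(** The common form of [theta] and its inverse. *)
Let shift (e : int) (u : Pr) : Pr -> Pr :=
  fext (fun o : option int => if o is Some j then copy (j + e)%R
                              else zext (fun k => u * beta k)).

Fact shift_factorM e u (o : option int) :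
  {morph (if o is Some j then copy (j + e)%R else zext (fun k => u * beta k)) :
    x y / x * y}.
Proof. by case: o => [j|]; [exact: copyM | exact: zextM]. Qed.

Fact shiftM e u : {morph shift e u : x y / x * y}.
Proof. exact: fextM (shift_factorM e u). Qed.

Fact shift_copy e u j m : shift e u (copy j m) = copy (j + e)%R m.
Proof. exact: (fext_syl (shift_factorM e u)). Qed.

Fact shift_beta e u k : shift e u (beta k) = u * beta k.
Proof. by rewrite [LHS](fext_syl (shift_factorM e u)) zext_fgen. Qed.

Let theta := shift 1%R (copy 0%R R)^-1.
(** [theta] carries [copy (-1) R] to [copy 0 R], which cancels the extra factor of
    [theta (beta k)]. *)
Let theta' := shift (-1)%R (copy (-1)%R R).

Fact thetaM : {morph theta : x y / x * y}. Proof. exact: shiftM. Qed.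
Fact theta_beta k : theta (beta k) = (copy 0%R R)^-1 * beta k.
Proof. exact: shift_beta. Qed.

Fact thetaK : cancel theta theta'.
Proof.
apply: Pr_hom_eq => // [x y|k|j m]; rewrite /theta /theta'.
- by rewrite !shiftM.
- rewrite shift_beta shiftM (morph_inv (@shiftM _ _)) shift_copy shift_beta add0r.
  by rewrite mulgA mulVg mul1g.
- by rewrite !shift_copy addrK.
Qed.

Fact theta'K : cancel theta' theta.
Proof.
apply: Pr_hom_eq => // [x y|k|j m]; rewrite /theta /theta'.
- by rewrite !shiftM.
- rewrite shift_beta shiftM shift_copy shift_beta addNr.
  by rewrite mulgA mulgV mul1g.
- by rewrite !shift_copy subrK.
Qed.

Let k0 : T := inl ord0.
(** [H] permutes the set [Pr]: [a] acts by an automorphism, [b] and the [z k] by left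
    translations. *)
Let act : H -> sym Pr := shom (Sym thetaK theta'K) (ltrans (beta k0))
  (fun k => ltrans (copy 0%R (fgen k))).

Fact act_z_word : W (fun k => ltrans (copy 0%R (fgen k))) = ltrans (copy 0%R R).
Proof.
pose f (x : B) := ltrans (copy 0%R x).
have fM : {morph f : x y / x * y} by move=> x y; rewrite /f copyM ltransM.
by rewrite -[RHS]/(f R) (morph_weval _ _ fM).
Qed.

(** The commutator of [theta] with translation by [beta k0] is translation by
    [theta (beta k0) * (beta k0)^-1], that is by [(copy 0 R)^-1]; the other handles contribute
    translation by [copy 0 R]. *)
Fact act_rel : Sym thetaK theta'K * ltrans (beta k0) * (Sym thetaK theta'K)^-1 *
  (ltrans (beta k0))^-1 * W (fun k => ltrans (copy 0%R (fgen k))) = 1.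
Proof.
rewrite act_z_word -(morph_inv (@ltransM _)); apply: sym_eqP => x.
rewrite !symM /= thetaM theta'K theta_beta.
by rewrite !mulgA mulgK mulVg mul1g.
Qed.

Fact actM : {morph act : x y / x * y}. Proof. exact: shomM act_rel. Qed.
Fact act_a p : act a p = theta p.
Proof. by rewrite /act (shom_a act_rel). Qed.
Fact act_b p : act b p = beta k0 * p.
Proof. by rewrite /act (shom_b act_rel). Qed.
Fact act_z k p : act (z k) p = copy 0%R (fgen k) * p.
Proof. by rewrite /act (shom_z act_rel). Qed.
Fact actV h p : act h (act h^-1 p) = p.
Proof. by rewrite -symM -actM mulgV (morph_one actM). Qed.

Fact act_C p : act C p = (copy 0%R R)^-1 * p.
Proof.
have actW : act (W z) = ltrans (copy 0%R R).
  rewrite (morph_weval _ _ actM) -act_z_word; apply: eq_weval => k.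
  by apply: sym_eqP => x; rewrite /= act_z.
by rewrite -[C]invgK -Wz (morph_inv actM) actW -(morph_inv (@ltransM _)).
Qed.

Let zeta : B -> H := zext z.
Let conja (j : int) (m : B) : H := zpow a j * zeta m * (zpow a j)^-1.
(** Reads off the element of [H] that an element of [Pr] stands for. *)
Let Psi : Pr -> H :=
  fext (fun o : option int => if o is Some j then conja j else zext (fun=> b)).

Fact zetaM : {morph zeta : x y / x * y}. Proof. exact: zextM. Qed.

Fact zeta_R : zeta R = C^-1.
Proof.
rewrite /R /surface_word (morph_weval _ _ zetaM) -Wz; apply: eq_weval => k.
exact: zext_fgen.
Qed.

Fact Psi_factorM (o : option int) :
  {morph (if o is Some j then conja j else zext (fun=> b)) : x y / x * y}.
Proof.
case: o => [j|]; last exact: zextM.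
by move=> x y; rewrite /conja zetaM !mulgA mulgVK.
Qed.

Fact PsiM : {morph Psi : x y / x * y}. Proof. exact: fextM Psi_factorM. Qed.
Fact Psi_copy j m : Psi (copy j m) = conja j m.
Proof. exact: (fext_syl Psi_factorM). Qed.
Fact Psi_None m : Psi (syl None m) = zext (fun=> b) m.
Proof. exact: (fext_syl Psi_factorM). Qed.
Fact Psi_beta k : Psi (beta k) = b.
Proof. by rewrite Psi_None zext_fgen. Qed.

Fact Psi_theta p : Psi (theta p) = a * Psi p * a^-1.
Proof.
have conjM : {morph (fun p : Pr => a * Psi p * a^-1) : x y / x * y}.
  by move=> x y; rewrite PsiM !mulgA mulgVK.
move: p; apply: Pr_hom_eq => // [x y|k|j m]; first by rewrite /theta shiftM PsiM.
  rewrite /theta shift_beta PsiM (morph_inv PsiM) Psi_copy Psi_beta.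
  by rewrite /conja /= zeta_R /C !gnorm.
rewrite /theta shift_copy !Psi_copy /conja addrC zpowS.
by rewrite !invgM !mulgA.
Qed.

(** [b] and [z k] act by left translations, whereas [a] acts by conjugation and leaves a power of
    [a] on the right. At [p = 1] this recovers [h] from [act h 1] up to a power of [a]. *)
Fact Psi_act h : exists n : int, forall p, Psi (act h p) = h * Psi p * zpow a n.
Proof.
move: h; apply: surface_ind => [|x y [m xE] [n yE]|x [n xE]|||k].
- by exists 0%R => p; rewrite (morph_one actM) /= mul1g mulg1.
- by exists (n + m)%R => p; rewrite actM symM xE yE zpowD !mulgA.
- exists (- n)%R => p; rewrite -[in RHS](actV x p) xE zpowN.
  by rewrite !mulgA mulVg mul1g mulgK.
- by exists (-1)%R => p; rewrite act_a Psi_theta.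
- by exists 0%R => p; rewrite act_b PsiM Psi_beta mulg1.
- exists 0%R => p; rewrite act_z PsiM Psi_copy /conja /= mul1g invg1 !mulg1.
  by rewrite /zeta zext_fgen.
Qed.

Let conjR (o : option int) (m : B) : B := if o is Some _ then R^-1 * m * R else m.

Fact conjRM o : {morph conjR o : x y / x * y}.
Proof. by case: o => [j|] // x y /=; rewrite !mulgA mulgK. Qed.

Fact conjR_inj o : injective (conjR o).
Proof. by case: o => [j|] // x y /= /mulIg /mulgI. Qed.

Let tau := fmap conjR.

Fact tauM : {morph tau : x y / x * y}. Proof. exact: fmapM conjRM. Qed.
Fact tau_beta k : tau (beta k) = beta k. Proof. exact: (fmap_syl conjRM). Qed.
Fact tau_copy j m : tau (copy j m) = copy j (R^-1 * m * R).
Proof. exact: (fmap_syl conjRM). Qed.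

(** On [beta k] the point is that [tau] fixes [copy 0 R], since conjugation by [R] fixes [R]. *)
Fact tau_theta p : tau (theta p) = theta (tau p).
Proof.
move: p; apply: Pr_hom_eq => [x y|x y|k|j m].
- by rewrite /theta shiftM tauM.
- by rewrite /theta tauM shiftM.
- rewrite tau_beta /theta shift_beta tauM (morph_inv tauM) tau_copy tau_beta.
  by rewrite mulVg mul1g.
- by rewrite tau_copy /theta !shift_copy tau_copy.
Qed.

(** For [a] this is [tau_theta], and [tau] fixes the [beta k]. For [z k], [C] acts as
    [(copy 0 R)^-1], so its conjugation by [C] matches that of [copy 0] by [R^-1] in [tau]. *)
Fact tau_act h p : tau (act h p) = act (psi1 h) (tau p).
Proof.
move: h p; apply: surface_ind => [|x y xE yE|x xE|||k] p.
- by rewrite (morph_one psi1M) (morph_one actM).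
- by rewrite actM symM xE yE psi1M actM.
- apply: (can_inj (@symK _ (act (psi1 x)))).
  by rewrite -xE actV (morph_inv psi1M) actV.
- by rewrite psi1_a !act_a tau_theta.
- by rewrite psi1_b !act_b tauM tau_beta.
- rewrite psi1_z 2!actM 2!symM (morph_inv actM) act_z tauM tau_copy 2!copyM.
  rewrite (morph_inv (@copyM _)) act_C act_z -!mulgA; do 2!congr (_ * _).
  by apply: (can_inj (@symK _ (act C))); rewrite act_C -symM mulgV /= mulKg.
Qed.

Let iota : F2 -> H := @zext bool H (fun x => if x then a else b).
Fact iotaM : {morph iota : x y / x * y}. Proof. exact: zextM. Qed.
Fact iota_X : iota X = a. Proof. by rewrite /iota zext_fgen. Qed.
Fact iota_Y : iota Y = b. Proof. by rewrite /iota zext_fgen. Qed.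

(** For a fixed [h], [tau] fixes [act h 1] and hence each of its syllables. In a copy [Some j] these
    commute with [R], so they are powers of [R] and evaluate to conjugates of powers of [C] by
    powers of [a]; in [None] they evaluate to powers of [b]. So [act h 1] evaluates into the
    subgroup of [a] and [b], and [h] differs from this value by a power of [a]. *)
Fact psi1_fixed h : psi1 h = h -> range iota h.
Proof.
move=> hE; have Ag := image_subgroup iotaM; have /is_subgroupP[A1 AM AV] := Ag.
have Aa : range iota a by exists X; rewrite ?iota_X.
have Ab : range iota b by exists Y; rewrite ?iota_Y.
have fix1 : tau (act h 1) = act h 1 by rewrite tau_act hE (morph_one tauM).
have [n /(_ 1)] := Psi_act h; rewrite (morph_one PsiM) mulg1 => PsiE.
rewrite -[h](mulgK (zpow a n)) -PsiE; apply: (AM); last first.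
  by apply: (AV); apply: zpow_subgroup.
have ind := fmap_fixed_ind conjRM conjR_inj
  (Q := fun p => range iota (Psi p)).
apply: (ind _ _ _ _ fix1).
- by rewrite (morph_one PsiM).
- by move=> p q Ap Aq; rewrite PsiM; exact: AM.
case=> [j|] m /=; last first.
  rewrite Psi_None => _; have zbM := @zextM T H (fun=> b).
  move: m; apply: fgen_ind => [|x y Ax Ay|x Ax|k].
  - by rewrite (morph_one zbM).
  - by rewrite zbM; exact: AM.
  - by rewrite (morph_inv zbM); exact: AV.
  - by rewrite zext_fgen.
move=> mR; rewrite -/(copy j m) Psi_copy /conja; apply: (AM); last first.
  by apply: (AV); apply: zpow_subgroup.
apply: (AM); first exact: zpow_subgroup.
(* The chosen subgroup consists of the elements that [zeta] sends into the range of [iota]; it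
   contains [R] because [zeta R = C^-1]. *)
apply: (@commute_surface_word _ (zeta @^-1` range iota)).
- apply/is_subgroupP; split=> /= [|x y Ax Ay|x Ax].
  + by rewrite (morph_one zetaM).
  + by rewrite zetaM; exact: AM.
  + by rewrite (morph_inv zetaM); exact: AV.
- rewrite /= -/R zeta_R; apply: (AV); rewrite /C.
  by apply: (AM); [apply: (AM); [exact: (AM) | exact: AV] | exact: AV].
- by rewrite -/R -{2}mR !mulgA mulgV mul1g.
Qed.

Lemma surface_group_fixed_retract : has_fixed_retract H.
Proof.
(* The second handle is folded onto the first with its generators exchanged and the others go to 1,
   so the relator becomes [X, Y] [Y, X] = 1. *)
pose fold (k : T) : F2 := sgen Y X (fun=> 1) k.
have fold_rel : X * Y * X^-1 * Y^-1 * W fold = 1.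
  by rewrite weval_sgen weval_one !gnorm.
have psi1_iota f : psi1 (iota f) = iota f.
  move: f; apply: fgen_hom_eq => [x y||[]]; [|exact: iotaM| |].
    by rewrite iotaM psi1M.
    by rewrite -/X iota_X psi1_a.
  by rewrite -/Y iota_Y psi1_b.
have psi0_iota f : psi0 (iota f) = iota (sign_change xpred0 f).
  move: f; apply: fgen_hom_eq => [x y|x y|i].
  - by rewrite iotaM psi0M.
  - by rewrite [sign_change _ _]zextM iotaM.
  rewrite /sign_change zext_fgen (morph_inv iotaM); case: i.
    by rewrite -/X iota_X psi0_a.
  by rewrite -/Y iota_Y psi0_b.
exists iota, (shom X Y fold), psi0, psi1; split; split.
- exact: iotaM.
- exact: shomM fold_rel.
- apply: fgen_hom_eq => // [x y|[]].
  + by rewrite iotaM (shomM fold_rel).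
  + by rewrite -/X iota_X (shom_a fold_rel).
  + by rewrite -/Y iota_Y (shom_b fold_rel).
- exact: psi0M.
- exact: psi0_bij.
(* A fixed point of [psi0] is fixed by its square [psi1], hence is some [iota f]; there [psi0]
   inverts both generators, so [f = 1]. *)
- move=> h hE; have [f _ fE] : range iota h.
    by apply: psi1_fixed; rewrite -psi0_psi0 !hE.
  have iotaK : cancel iota (shom X Y fold).
    apply: fgen_hom_eq => // [x y|[]].
    + by rewrite iotaM (shomM fold_rel).
    + by rewrite -/X iota_X (shom_a fold_rel).
    + by rewrite -/Y iota_Y (shom_b fold_rel).
  rewrite -fE; suff -> : f = 1 by exact: morph_one iotaM.
  apply: (@sign_change_fixed _ xpred0 [set 1]) => //.
    apply/is_subgroupP; split=> // [_ _ -> ->|_ ->]; first by rewrite /= mulg1.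
    by rewrite /= invg1.
  by apply: (can_inj iotaK); rewrite -psi0_iota fE hE.
- exact: psi1M.
- exact: psi1_bij.
- apply/seteqP; split=> [h|_ [f _ <-]]; [exact: psi1_fixed | exact: psi1_iota].
Qed.

End SurfaceGroups.

Lemma fixed_retract_spectrum (H : groupType) (k : nat) :
  countable [set: H] -> has_fixed_retract H ->
  let G := dprod_group H (free_abelian_group k.+2) in
  [set rk (Fix phi) | phi in @Aut_group G] =
    [set FinCard n | n in [set: nat]] `|` [set Aleph0] /\
  infinite_set [set iso_class (Fix phi) | phi in @Aut_group G].
Proof.
move=> Hc Hr G; apply: rank_spectrum; last exact: fixed_ranks.
exact: countable_dprod.
Qed.

Theorem theorem1p1 (g k : nat) (hg : (2 <= g)%N) (hk : (2 <= k)%N)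
    (G : groupType)
    (hG : G = dprod_group (surface_group g) (free_abelian_group k) \/
          G = dprod_group (free_group g) (free_abelian_group k)) :
  [set rk (Fix phi) | phi in @Aut_group G] =
    [set FinCard n | n in [set: nat]] `|` [set Aleph0] /\
  infinite_set [set iso_class (Fix phi) | phi in @Aut_group G].
Proof.
case: g hg hG => [|[|g]] // _ hG; case: k hk hG => [|[|k]] // _ [] ->;
  apply: fixed_retract_spectrum; try exact: countable_presented.
  exact: surface_group_fixed_retract.
exact: free_group_fixed_retract.
Qed.
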